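(* Let $\mathbb{T}$ be a PCR-based cycle-joining tree satisfying the Chain Property. Let $\mathcal{T}_1 = \mathrm{Concat}(\mathbb{T},c,\mathit{left})$ be the left concatenation tree and $\mathcal{T}_2 = \mathrm{Concat}(\mathbb{T},c,\mathit{right})$ the right concatenation tree derived from $\mathbb{T}$ with root change index $c$. Then - $\mathrm{RCL}(\mathcal{T}_1)$ is a universal cycle for $\mathbf{S}_{\mathbb{T}}$ with successor rule ${\uparrow}f_1$, and - $\mathrm{RCL}(\mathcal{T}_2)$ is a universal cycle for $\mathbf{S}_{\mathbb{T}}$ with successor rule ${\downarrow}f_1$.
   Context: Let $\Sigma=\{0,1,\ldots,k-1\}$. The aperiodic prefix of a string $\alpha$ is the shortest $\beta$ with $\alpha=\beta^t$ for some $t\ge 1$; $|\beta|$ is the period, and $\alpha$ is periodic if the period is less than $n=|\alpha|$. $\mathrm{ap}(\alpha_1,\ldots,\alpha_t)$ is the concatenation of the aperiodic prefixes of $\alpha_1,\ldots,\alpha_t$. The necklace class $[\alpha]$ is the set of rotations of $\alpha$; these are exactly the cycles induced by the pure cycling register (PCR) $f(\tt{a}_1\cdots\tt{a}_n)=\tt{a}_1$. A universal cycle for $\mathbf{S}\subseteq\Sigma^n$ is a cyclic sequence of length $|\mathbf{S}|$ containing every string of $\mathbf{S}$ exactly once as a substring; a successor rule is a function $f:\mathbf{S}\to\Sigma$ giving the symbol following each string in the universal cycle. If $\tt{x}\neq\tt{y}$, $(\tt{x}\tt{a}_2\cdots\tt{a}_n,\tt{y}\tt{a}_2\cdots\tt{a}_n)$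 is a conjugate pair. A PCR-based cycle-joining tree $\mathbb{T}$ is a rooted unordered tree whose nodes are distinct necklace classes (labeled by necklace representatives $\alpha_1,\ldots,\alpha_t$), where each edge between two nodes is given by a conjugate pair with one string in each of the two classes; $\mathbf{C}$ denotes this set of conjugate pairs and $\mathbf{S}_{\mathbb{T}}=[\alpha_1]\cup\cdots\cup[\alpha_t]$. Chain Property: if a node has two children joined via conjugate pairs $(\tt{x}\tt{a}_2\cdots\tt{a}_n,\tt{y}\tt{a}_2\cdots\tt{a}_n)$ and $(\tt{x}'\tt{b}_2\cdots\tt{b}_n,\tt{y}'\tt{b}_2\cdots\tt{b}_n)$, then $\tt{a}_2\cdots\tt{a}_n\neq\tt{b}_2\cdots\tt{b}_n$. Successor rules: a chain is a maximal path $\alpha_1,\ldots,\alpha_m$ in $\mathbb{T}$ with $\alpha_i$ the parent of $\alpha_{i+1}$ joined via a conjugate pair $(\tt{x}_i\beta,\tt{x}_{i+1}\beta)$ with the same $\beta$ for all $i$. Assign each chain a derangement $d_1\cdots d_m$ of $\{1,\ldots,m\}$; if $\alpha=\tt{x}_i\beta$ belongs to a conjugate pair joining two nodes of that chain, set $g(\alpha)=\tt{x}_{d_i}$. Define $f_1(\alpha)=g(\alpha)$ if $\alpha=\tt{a}_1\cdots\tt{a}_n$ belongs to a conjugate pair in $\mathbf{C}$, and $f_1(\alpha)=\tt{a}_1$ otherwise. ${\uparrow}f_1$ is $f_1$ when every chain derangement is $23\cdots m1$, and ${\downarrow}f_1$ is $f_1$ when every chain derangement is $m12\cdots(m{-}1)$.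 Concatenation trees: $\mathrm{Concat}(\mathbb{T},c,\cdot)$ has the same nodes and parent–child relations as $\mathbb{T}$, but with relabeled representatives and change indices defined recursively. The root keeps its label and gets (arbitrary) change index $c\in\{1,\ldots,n\}$. For a labeled node $\alpha=(\tt{a}_1\cdots\tt{a}_p)^q$ of period $p$ with change index $c'$, where $jp<c'\le jp+p$, its acceptable range is $\{jp+1,\ldots,jp+p\}$ (all of $\{1,\ldots,n\}$ if $\alpha$ is aperiodic). If a child $\gamma$ is joined to $\alpha$ in $\mathbb{T}$ via the conjugate pair $(\tt{x}\beta_2\beta_1,\tt{y}\beta_2\beta_1)$, write $\alpha=\beta_1\tt{x}\beta_2$ uniquely with $\tt{x}$ at an index $i$ in the acceptable range; then $\gamma$ is labeled $\beta_1\tt{y}\beta_2$ with change index $i$. Children of a node with change index $c'$ having change index $<c'$ are left-children and those with change index $>c'$ are right-children, each ordered by increasing change index; children with change index equal to $c'$ are left-children in the left concatenation tree and right-children in the right concatenation tree. An RCL traversal recursively visits all right-children (first to last), then the current node, then all left-children (first to last); $\mathrm{RCL}(\mathcal{T})=\mathrm{ap}(\alpha_1,\ldots,\alpha_t)$ where $\alpha_1,\ldots,\alpha_t$ are the node labels in RCL order. *)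

(* Defs.v *)
From mathcomp Require Import all_boot.

Set Implicit Arguments.
Unset Strict Implicit.
Unset Printing Implicit Defensive.

(* Strings over {0,...,k-1} are tuples of length n.+1: the string length is     *)
(* positive.  String positions (change indices) are numbered from 1.            *)
Notation word k n := (n.+1.-tuple 'I_k).

Section Strings.
Variable T : eqType.
Implicit Types s : seq T.

Definition is_power_of_prefix s p :=
  has (fun t => s == flatten (nseq t (take p s))) (iota 1 (size s)).

(* Any b with s = b^t, t >= 1, is a prefix of s, so the least admissible prefix *)
(* length is the period.                                                        *)
Definition period s := find (is_power_of_prefix s) (iota 0 (size s).+1).

Definition aperiodic_prefix s := take (period s) s.

Definition ap (ss : seq (seq T)) : seq T := flatten [seq aperiodic_prefix s | s <- ss].

Definition occurs_at (U : seq T) (i : nat) (w : seq T) :=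
  [seq onth U ((i + j) %% size U) | j <- iota 0 (size w)] == [seq Some a | a <- w].

End Strings.

Definition universal_cycle k n (S : {set word k n}) (U : seq 'I_k) :=
  size U = #|S| /\
  forall w : word k n, w \in S -> exists! i, i < size U /\ occurs_at U i w.

Definition has_successor_rule k n (S : {set word k n}) (U : seq 'I_k)
    (f : word k n -> 'I_k) :=
  forall (w : word k n) (i : nat), w \in S -> i < size U ->
    occurs_at U i w -> occurs_at U i (rcons w (f w)).

Definition necklace_class k n (a : word k n) : {set word k n} :=
  [set [tuple of rot i a] | i : 'I_n.+1].

(* (x, y, b) stands for the pair of strings (x b, y b); it is a conjugate pair  *)
(* when x != y.                                                                 *)
Definition cpair k n := ('I_k * 'I_k * n.-tuple 'I_k)%type.

(* A node carries a representative of its necklace class and its children, each *)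
(* with a pair (x, y, b) such that x b lies in the class of the node and y b in *)
(* the class of the child.  The listing order of the children is irrelevant:    *)
(* nothing below depends on it.                                                 *)
Inductive tree k n := Node of word k n & seq (cpair k n * tree k n).

Section CycleJoiningTree.
Variables k n : nat.
Implicit Types (T : tree k n) (a : word k n) (b : n.-tuple 'I_k).

Definition root_label T := let: Node a _ := T in a.

Fixpoint nodes T : seq (word k n) :=
  let: Node a ch := T in a :: flatten [seq nodes e.2 | e <- ch].

(* ((parent, child), pair) *)
Fixpoint edges T : seq (word k n * word k n * cpair k n) :=
  let: Node a ch := T in
  flatten [seq (a, root_label e.2, e.1) :: edges e.2 | e <- ch].

Definition valid_edge (e : word k n * word k n * cpair k n) :=
  let: (p, c, (x, y, b)) := e in
  [&& x != y, [tuple of x :: b] \in necklace_class p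
    & [tuple of y :: b] \in necklace_class c].

Definition cycle_joining_tree T :=
  uniq [seq necklace_class a | a <- nodes T] /\ all valid_edge (edges T).

Definition strings_of T : {set word k n} := \bigcup_(a <- nodes T) necklace_class a.

Definition chain_property T :=
  forall (p c c' : word k n) (x y x' y' : 'I_k) (b b' : n.-tuple 'I_k),
    (p, c, (x, y, b)) \in edges T -> (p, c', (x', y', b')) \in edges T ->
    c != c' -> b != b'.

(* The downward path a_1, ..., a_m joined by (x_i b, x_(i+1) b) is encoded by b *)
(* and the sequence (a_1, x_1), ..., (a_m, x_m).                                *)
Definition is_path T b (s : seq (word k n * 'I_k)) :=
  sorted (fun u v => (u.1, v.1, (u.2, v.2, b)) \in edges T) s.

Definition is_chain T b (s : seq (word k n * 'I_k)) :=
  [&& 1 < size s, is_path T b s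
    & [forall u, ~~ is_path T b (u :: s) && ~~ is_path T b (rcons s u)]].

(* The chain containing a = x_i b.  A path does not repeat nodes, so its length *)
(* is at most the number of nodes; the chain is unique under the Chain Property.*)
Definition chain_of T a : option {bseq (size (nodes T)) of (word k n * 'I_k)} :=
  [pick s : {bseq (size (nodes T)) of (word k n * 'I_k)} |
     is_chain T [tuple of behead a] s && (thead a \in unzip2 s)].

(* A derangement d_1 ... d_m of {1, ..., m} is given in one-line notation, by   *)
(* an assignment d sending each chain to one.                                   *)
Definition g T (d : seq (word k n * 'I_k) -> seq nat) a : 'I_k :=
  if chain_of T a is Some s then
    let xs := unzip2 s in
    nth (thead a) xs (nth 0 (d s) (index (thead a) xs)).-1
  else thead a.

Definition in_conjugate_pair T a :=
  has (fun e : word k n * word k n * cpair k n =>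
         let: (_, _, (x, y, b)) := e in
         (a == [tuple of x :: b]) || (a == [tuple of y :: b])) (edges T).

Definition f1 T (d : seq (word k n * 'I_k) -> seq nat) a : 'I_k :=
  if in_conjugate_pair T a then g T d a else thead a.

(* 2 3 ... m 1 *)
Definition up_f1 T := f1 T (fun s => rot 1 (iota 1 (size s))).

(* m 1 2 ... (m-1) *)
Definition down_f1 T := f1 T (fun s => rotr 1 (iota 1 (size s))).

End CycleJoiningTree.

Inductive side := left_side | right_side.

(* label, change index, left-children, right-children *)
Inductive ctree k := CNode of seq 'I_k & nat & seq (ctree k) & seq (ctree k).

Definition change_index k (t : ctree k) := let: CNode _ c _ _ := t in c.

Definition acceptable_range k (a : seq 'I_k) (c : nat) : seq nat :=
  let p := period a in iota (c.-1 %/ p * p).+1 p.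

(* The index i in the acceptable range with a = b1 x b2, |b1| = i - 1, and      *)
(* x b2 b1 = x b; the default 0 is reached only if there is none.               *)
Definition child_index k n (a : seq 'I_k) (c : nat) (e : cpair k n) : nat :=
  let: (x, y, b) := e in
  head 0 [seq i <- acceptable_range a c | rot i.-1 a == x :: b].

Definition child_label k n (a : seq 'I_k) (i : nat) (e : cpair k n) : seq 'I_k :=
  let: (x, y, b) := e in take i.-1 a ++ y :: drop i a.

Definition is_left_child (d : side) (c i : nat) : bool :=
  match d with left_side => i <= c | right_side => i < c end.

Fixpoint relabel k n (d : side) (a : seq 'I_k) (c : nat) (T : tree k n) : ctree k :=
  let: Node _ ch := T in
  let kids :=
    sort (fun t t' => change_index t <= change_index t')
      [seq (let i := child_index a c e.1 in relabel d (child_label a i e.1) i e.2)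
      | e <- ch] in
  CNode a c [seq t <- kids | is_left_child d c (change_index t)]
            [seq t <- kids | ~~ is_left_child d c (change_index t)].

Definition Concat k n (T : tree k n) (c : nat) (d : side) : ctree k :=
  relabel d (root_label T) c T.

Fixpoint rcl_labels k (t : ctree k) : seq (seq 'I_k) :=
  let: CNode a _ l r := t in
  flatten [seq rcl_labels u | u <- r] ++ a :: flatten [seq rcl_labels u | u <- l].

Definition RCL k (t : ctree k) : seq 'I_k := ap (rcl_labels t).

(* Main.v *)
Require Import Defs.
From mathcomp Require Import all_boot.
From HB Require Import structures.
From mathcomp Require Import zify.
From mathcomp Require boolp.

Set Implicit Arguments.
Unset Strict Implicit.
Unset Printing Implicit Defensive.

(**
Cutting the contribution [W] of a subtree whose root has label [b1 y b2] and
change index [|b1| + 1] out of the RCL sequence, the text [b2 W b1] starts and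
ends with [b = b2 b1], so it is a closed walk through the vertex [b] of the de
Bruijn graph.  By induction on the tree, this walk reads every string of the
subtree exactly once, and follows the successor rule everywhere except at its
last string [l b], whose successor depends on the rest of the tree.  A single
necklace gives such a walk.  A child with pair [(x b', z b')] contributes a
closed walk through [b'], and the place of that child in the RCL order is one
where the text of the parent passes through [b']; inserting the walk there
swaps the successors of the two strings entering [b'], which is what the
derangement of the chain prescribes.  Whether the child whose change index
equals that of its parent comes last (left) or first (right) decides in which
direction the chain is cycled.
*)

(** * Windows, rotations and periods *)

Section Windows.
Variables (A : eqType) (n : nat).
Implicit Types s t u : seq A.

(** Multiplicities are kept, so that a permutation statement says that each string is read exactly
    once. *)
Definition windows s := [seq take n.+1 (drop i s) | i <- iota 0 (size s - n)].

Lemma size_windows s : size (windows s) = size s - n.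
Proof. by rewrite size_map size_iota. Qed.

(** An overlap of [n] letters is just right: a window starting in [u] ends within [u ++ s], and
    every other window lies in [s ++ t], so none is lost or counted twice. *)
Lemma windows_cat u s t : size s = n ->
  windows (u ++ s ++ t) = windows (u ++ s) ++ windows (s ++ t).
Proof.
move=> hs; rewrite /windows !size_cat hs.
have -> : size u + (n + size t) - n = size u + size t by lia.
have -> : size u + n - n = size u by lia.
have -> : n + size t - n = size t by lia.
rewrite iotaD map_cat add0n; congr (_ ++ _).
  apply/eq_in_map => i; rewrite mem_iota add0n => /andP[_ hi].
  rewrite catA (drop_cat i (u ++ s)) size_cat hs ltn_addr // take_cat size_drop size_cat hs.
  case: ltnP => // hi'; have -> : n.+1 - (size u + n - i) = 0 by lia.
  by rewrite take0 cats0 take_oversize // size_drop size_cat hs; lia.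
rewrite -[X in iota X]addn0 iotaDl -map_comp; apply/eq_in_map => i _ /=.
by rewrite drop_cat; case: ltnP => [|_]; [lia | rewrite addKn].
Qed.

Lemma mem_windows u s : (u \in windows s) = (size u == n.+1) && infix u s.
Proof.
apply/mapP/andP => [[i]|[/eqP hu /infixP[v [w ->]]]].
  rewrite mem_iota add0n => /andP[_ hi] ->.
  split; first by rewrite size_takel // size_drop; lia.
  by apply/infixP; exists (take i s), (drop n.+1 (drop i s)); rewrite !cat_take_drop.
exists (size v); first by rewrite mem_iota /= !size_cat; lia.
by rewrite drop_size_cat // take_size_cat.
Qed.

Lemma infix_cat_overlap u s t w : size s = n -> size w = n.+1 ->
  infix w (u ++ s ++ t) = infix w (u ++ s) || infix w (s ++ t).
Proof.
move=> hs hw; have H v : infix w v = (w \in windows v) by rewrite mem_windows hw eqxx.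
by rewrite !H windows_cat // mem_cat.
Qed.

(** Insertion of a closed walk [v] at a passage through the vertex [s]: cutting the new text at the
    first and at the last copy of [s] in [v] leaves the windows of the old text and those of [v]. *)
Lemma perm_windows_glue u s t v : size s = n -> prefix s v -> suffix s v ->
  perm_eq (windows (u ++ v ++ t)) (windows (u ++ s ++ t) ++ windows v).
Proof.
move=> hs /prefixP[v1 hv1] /suffixP[v2 hv2].
have -> : u ++ v ++ t = u ++ s ++ (v1 ++ t) by rewrite hv1 -!catA.
have hst : s ++ v1 ++ t = v2 ++ s ++ t by rewrite !catA -hv1 hv2.
rewrite windows_cat // hst windows_cat // -hv2 [windows (u ++ s ++ t)]windows_cat //.
by rewrite -catA perm_cat2l perm_catC.
Qed.

End Windows.

(** Words of length [n.+2] record a string together with its successor. Cutting at overlaps of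
    length [n.+1] shows that inserting [v] can break only the one that straddles all of [b]. *)
Lemma infix_glue_mid (A : eqType) n (u : seq A) x b y t v w : size b = n -> size w = n.+2 ->
  prefix b v -> suffix b v -> infix w (rcons u x ++ b ++ y :: t) ->
  infix w (rcons u x ++ v ++ y :: t) \/ w = x :: rcons b y.
Proof.
move=> hb hw /prefixP[v1 hv1] /suffixP[v2 hv2].
have -> : rcons u x ++ b ++ y :: t = u ++ (x :: b) ++ y :: t by rewrite cat_rcons.
rewrite (infix_cat_overlap (n := n.+1)); [|by rewrite /= hb|by []].
have -> : (x :: b) ++ y :: t = [:: x] ++ rcons b y ++ t by rewrite cat_rcons.
rewrite (infix_cat_overlap (n := n.+1)) ?size_rcons ?hb // => /or3P[] h.
- by left; rewrite hv1 cat_rcons -catA -cat_cons catA infix_catr.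
- right; case/infixP: h => w1 [w2 h].
  have := congr1 size h; rewrite !size_cat size_rcons hb hw /= => E0.
  have w10 : w1 = [::] by apply: size0nil; lia.
  have w20 : w2 = [::] by apply: size0nil; lia.
  by move: h; rewrite w10 w20 cats0.
- by left; rewrite hv2 -[y :: t]cat1s -!catA catA infix_catl // catA cats1.
Qed.

(** * Iterated rotations and necklace classes as lists *)

Section Rotations.
Variable A : eqType.
Implicit Types s t u : seq A.

(** [rot] is the identity beyond the length; iterating single rotations gives an action of the
    natural numbers, so exponents add freely. *)
Definition turn j s := iter j (rot 1) s.

Lemma size_turn j s : size (turn j s) = size s.
Proof. by elim: j => //= j; rewrite size_rot. Qed.

Lemma turnD i j s : turn (i + j) s = turn i (turn j s).
Proof. exact: iterD. Qed.

Lemma turn_rot j s : j <= size s -> turn j s = rot j s.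
Proof.
elim: j => [|j IH] hj; first by rewrite rot0.
by rewrite rotS //= IH // ltnW.
Qed.

Lemma turn_inj j : injective (turn j).
Proof. by elim: j => // j IH s t /rot_inj /IH. Qed.

Lemma turn_size s : turn (size s) s = s.
Proof. by rewrite turn_rot // rot_size. Qed.

Lemma turn_mul j m s : turn j s = s -> turn (m * j) s = s.
Proof. by move=> h; elim: m => // m IH; rewrite mulSn turnD IH. Qed.

Lemma turn_modn j d s : turn d s = s -> turn (j %% d) s = turn j s.
Proof. by move=> h; rewrite {2}(divn_eq j d) addnC turnD turn_mul. Qed.

Lemma turn_rot_modn j s : 0 < size s -> turn j s = rot (j %% size s) s.
Proof. by move=> hs; rewrite -turn_rot ?turn_modn ?turn_size // ltnW // ltn_pmod. Qed.

Lemma nth_turn x0 j s i : i < size s -> nth x0 (turn j s) i = nth x0 s ((j + i) %% size s).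
Proof.
move=> hi; have hs : 0 < size s by apply: leq_ltn_trans hi.
have hj : j %% size s < size s by rewrite ltn_pmod.
rewrite turn_rot_modn // /rot nth_cat size_drop nth_drop -[in RHS]modnDml.
move: (j %% size s) hj => {}j hj; case: ltnP => h; first by rewrite modn_small //; lia.
rewrite nth_take; last by lia.
congr (nth _ _ _).
have -> : j + i = i - (size s - j) + size s by lia.
by rewrite modnDr modn_small //; lia.
Qed.

Lemma turn_gcd i j s : 0 < i -> turn i s = s -> turn j s = s -> turn (gcdn i j) s = s.
Proof.
move=> i0 hi hj; case: (egcdnP j i0) => u v h _.
have : turn (u * i) s = s by apply: turn_mul.
by rewrite h addnC turnD turn_mul.
Qed.

Definition rotations s := undup [seq rot i s | i <- iota 0 (size s)].

Lemma mem_rotations s u : 0 < size s ->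
  reflect (exists j, u = turn j s) (u \in rotations s).
Proof.
move=> hs; rewrite mem_undup; apply: (iffP mapP) => [[i]|[j ->]].
  rewrite mem_iota add0n => /= hi ->; exists i; rewrite turn_rot //; exact: ltnW.
by exists (j %% size s); rewrite ?turn_rot_modn // mem_iota /= add0n ltn_pmod.
Qed.

Lemma turn_inv j s : exists i, turn i (turn j s) = s.
Proof.
exists (j * (size s).-1); rewrite -turnD.
case: (posnP (size s)) => [h|h].
  by rewrite (size0nil h); elim: (_ + _) => //= m ->.
have -> : j * (size s).-1 + j = j * size s by rewrite -{2}(prednK h) mulnS addnC.
by rewrite turn_mul ?turn_size.
Qed.

Lemma size_mem_rotations s u : u \in rotations s -> size u = size s.
Proof. by rewrite mem_undup => /mapP[i _ ->]; rewrite size_rot. Qed.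

Lemma rotations_turn j s : 0 < size s -> rotations (turn j s) =i rotations s.
Proof.
move=> hs u; apply/mem_rotations/mem_rotations; rewrite ?size_turn // => -[i ->].
  by exists (i + j); rewrite turnD.
by have [m hm] := turn_inv j s; exists (i + m); rewrite turnD hm.
Qed.

Lemma perm_rotations s u : u \in rotations s -> perm_eq u s.
Proof. by rewrite mem_undup => /mapP[i _ ->]; rewrite perm_rot. Qed.

(* Rotations have the same letters with multiplicity. *)
Lemma rotations_head_inj s x y u :
  x :: u \in rotations s -> y :: u \in rotations s -> x = y.
Proof.
move=> /perm_rotations hx /perm_rotations; rewrite perm_sym => hy.
have /permP/(_ (pred1 x)) /= := perm_trans hx hy.
by rewrite eqxx; case: eqP => // _ /eqP; rewrite eqn_add2r.
Qed.

End Rotations.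


(** * The period as least rotation dividing the length *)

Section Period.
Variable A : eqType.
Implicit Types s t u : seq A.

Lemma take_add_period s p m : rot p s = s -> m + p <= size s ->
  take (m + p) s = take p s ++ take m s.
Proof.
move=> h hm; rewrite addnC takeD; congr (_ ++ _).
by rewrite -{2}h /rot take_cat size_drop; case: ltnP => // h';
  rewrite take_oversize ?size_drop // (_ : m - _ = 0) ?take0 ?cats0 //; lia.
Qed.

Lemma drop_add_period s p m : rot p s = s -> m + p <= size s ->
  drop m s = drop (m + p) s ++ take p s.
Proof.
move=> h hm; rewrite -{1}h /rot drop_cat size_drop drop_drop; case: ltnP => // h'.
have -> : m - (size s - p) = 0 by lia.
by rewrite drop0 drop_oversize //; lia.
Qed.

Lemma take_mul_period s p m : rot p s = s -> m * p <= size s ->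
  take (m * p) s = flatten (nseq m (take p s)).
Proof.
move=> h; elim: m => [|m IH]; first by rewrite take0.
by rewrite mulSnr => hm; rewrite take_add_period // IH //=; lia.
Qed.

(** The search in [period] succeeds because the whole string is a power of itself, and a power of
    [u] is fixed by the rotation by the length of [u]. *)
Lemma periodP s : 0 < size s ->
  [/\ 0 < period s, period s %| size s & rot (period s) s = s].
Proof.
move=> hs; have h : has (is_power_of_prefix s) (iota 0 (size s).+1).
  apply/hasP; exists (size s); first by rewrite mem_iota add0n ltnS leqnn.
  by apply/hasP; exists 1; rewrite ?mem_iota ?add1n ?ltnS //= take_size cats0.
have hlt : period s < (size s).+1 by rewrite -[X in _ < X](size_iota 0) -has_find.
have := nth_find 0 h; rewrite nth_iota ?add0n // -/(period s).
case/hasP => t; rewrite mem_iota => /andP[t0 _] /eqP hp.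
have hszt : size (take (period s) s) = period s by rewrite size_takel.
have hsz : size s = t * period s.
  by rewrite {1}hp size_flatten /shape map_nseq sumn_nseq hszt mulnC.
have p0 : 0 < period s by move: hs; rewrite hsz muln_gt0 => /andP[].
split=> //; first by rewrite hsz dvdn_mull.
case: t t0 hp {hsz} => // t _ hp; set u := take _ _ in hszt hp.
by rewrite {2}hp /= -{1}hszt rot_size_cat [RHS]hp -addn1 nseqD flatten_cat /= cats0.
Qed.

Lemma period_min s d : 0 < d -> d %| size s -> rot d s = s -> period s <= d.
Proof.
move=> d0 hd h; rewrite leqNgt; apply/negP => hlt.
have := before_find 0 hlt; case: (posnP (size s)) => hs.
  by move: hlt; rewrite /period (size0nil hs) /=; case: d d0 {hd h}.
have hle := dvdn_leq hs hd.
rewrite nth_iota ?ltnS // add0n => /negP; apply; apply/hasP; exists (size s %/ d).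
  by rewrite mem_iota divn_gt0 // hle add1n ltnS leq_div.
by rewrite -take_mul_period // divnK // take_size.
Qed.

Lemma turn_period s : 0 < size s -> turn (period s) s = s.
Proof. by move=> hs; have [_ /(dvdn_leq hs) h] := periodP hs; rewrite turn_rot. Qed.

(** If two of these turns agreed, the gcd of their distance with the length would divide the length,
    fix [s] as a rotation, and be smaller than the period. *)
Lemma turn_period_inj s i j : 0 < size s -> i < period s -> j < period s ->
  turn i s = turn j s -> i = j.
Proof.
move=> hs; wlog hij : i j / i <= j.
  by move=> H hi hj h; case: (leqP i j) => [|/ltnW] /H ->.
move=> hi hj h; have hji : turn (j - i) s = s.
  have [m hm] := turn_inv i s.
  have : turn (j - i) (turn m (turn i s)) = turn m (turn i s).
    by rewrite -(turnD m) -(turnD (j - i)) addnCA subnK // turnD -h -turnD.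
  by rewrite hm.
apply/eqP; rewrite eqn_leq hij leqNgt; apply/negP => hlt.
have d0 : 0 < j - i by rewrite subn_gt0.
have hd : gcdn (j - i) (size s) <= j - i by rewrite dvdn_leq ?dvdn_gcdl.
have /(period_min _ _) : rot (gcdn (j - i) (size s)) s = s.
  rewrite -turn_rot; last by rewrite dvdn_leq ?dvdn_gcdr.
  by rewrite turn_gcd ?turn_size.
by rewrite gcdn_gt0 d0 dvdn_gcdr => /(_ isT isT); lia.
Qed.

End Period.

(** * The closed walk of a single necklace *)

Section RotationWalk.
Variables (A : eqType) (n c : nat) (s : seq A).
Hypotheses (hs : size s = n.+1) (hc : 0 < c <= n.+1).

(** With [s = b1 y b2] and [c = |b1| + 1] this is [b2 W b1], where [W] is the aperiodic prefix: the
    periodic continuation of [s] from just after [y]. *)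
Let t := drop c s ++ take (period s) s ++ take c.-1 s.

Let hs0 : 0 < size s. Proof. by rewrite hs. Qed.

Let hp : 0 < period s <= n.+1.
Proof. by have [p0 /(dvdn_leq hs0)] := periodP hs0; rewrite hs p0. Qed.

Lemma size_rotation_walk : size t = n + period s.
Proof. by rewrite !size_cat size_drop !size_takel ?hs; lia. Qed.

Lemma nth_rotation_walk x0 i : i < n + period s ->
  nth x0 t i = nth x0 s ((c + i) %% n.+1).
Proof.
have [_ _ hr] := periodP hs0; have [hp1 hp2] := andP hp.
rewrite /t; move: (period s) hr hp1 hp2 => p hr hp1 hp2 hi.
rewrite !nth_cat size_drop size_takel ?hs //; case: ltnP => h1.
  by rewrite nth_drop modn_small //; lia.
case: ltnP => h2.
  have -> : c + i = i - (n.+1 - c) + n.+1 by lia.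
  by rewrite nth_take // modnDr modn_small //; lia.
rewrite nth_take; last by lia.
have -> : c + i = i - (n.+1 - c) - p + p + n.+1 by lia.
rewrite modnDr addnC -hs -nth_turn ?hs; last by lia.
by rewrite turn_rot ?hr ?hs.
Qed.

Lemma windows_rotation_walk :
  windows n t = [seq turn (c + i) s | i <- iota 0 (period s)].
Proof.
rewrite /windows size_rotation_walk addKn; apply/eq_in_map => i.
rewrite mem_iota add0n => /andP[_ hi]; case E : s hs => [|x0 s'] // _; rewrite -E.
apply: (@eq_from_nth _ x0) => [|j].
  by rewrite size_takel ?size_turn // size_drop size_rotation_walk; lia.
rewrite size_takel; last by rewrite size_drop size_rotation_walk; lia.
move=> hj; rewrite nth_take // nth_drop nth_rotation_walk; last by lia.
by rewrite nth_turn ?hs // addnA.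
Qed.

Lemma perm_windows_rotation_walk : perm_eq (windows n t) (rotations s).
Proof.
have [hp1 hp2] := andP hp.
rewrite windows_rotation_walk; apply: uniq_perm; last first.
- move=> u; apply/mapP/(mem_rotations _ hs0) => [[i _ ->]|[j ->]]; first by exists (c + i).
  have [m hm] := turn_inv c s.
  exists ((j + m) %% period s); first by rewrite mem_iota add0n ltn_pmod.
  rewrite turnD turn_modn ?turn_period // -turnD.
  have -> : c + (j + m) = j + (m + c) by lia.
  by rewrite turnD turnD hm.
- exact: undup_uniq.
rewrite map_inj_in_uniq ?iota_uniq // => i j; rewrite !mem_iota !add0n !turnD => /= hi hj h.
exact: turn_period_inj hs0 hi hj (turn_inj h).
Qed.

(** The text obeys the pure cycling register: each string is followed by its own first letter. Only
    the last window, [y b2 b1], has no letter after it. *)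
Lemma infix_rotation_walk u x : u \in rotations s -> ohead u = Some x ->
  u != drop c.-1 s ++ take c.-1 s -> infix (rcons u x) t.
Proof.
have [hp1 hp2] := andP hp.
rewrite -(perm_mem perm_windows_rotation_walk) => /mapP[i].
rewrite mem_iota add0n size_rotation_walk addKn => /andP[_ hi] -> hx hne.
have hut : take n.+1 (drop i t) = turn (c + i) s.
  have := windows_rotation_walk => /(congr1 (fun w => nth [::] w i)).
  by rewrite !(nth_map 0) ?size_iota ?size_rotation_walk ?addKn // nth_iota // add0n.
(* The window numbered [(period s).-1] is the last one; dropping a full period from its turn
   identifies it with the excluded rotation. *)
case: (leqP (period s) i.+1) => hi1.
  case/eqP: hne; rewrite hut; have -> : c + i = c.-1 + period s by lia.
  by rewrite turnD turn_period // turn_rot // hs; lia.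
apply/infixP; exists (take i t), (drop (i + n.+2) t).
have -> : rcons (take n.+1 (drop i t)) x = take n.+2 (drop i t).
  rewrite [RHS](take_nth x) ?size_drop ?size_rotation_walk; last by lia.
  congr (rcons _ _); move: hx; rewrite hut.
  have -> : ohead (turn (c + i) s) = Some (nth x (turn (c + i) s) 0).
    by case E : (turn _ _) (size_turn (c + i) s) => //; rewrite hs.
  case=> <-; rewrite nth_drop nth_rotation_walk; last by lia.
  rewrite nth_turn // addn0 addnA hs modnDr.
  by apply: set_nth_default; rewrite hs ltn_pmod.
by rewrite addnC -drop_drop !cat_take_drop.
Qed.

End RotationWalk.

(** * Closed walks and their insertion *)

Section ClosedWalks.
Variables (k n : nat) (f : word k n -> 'I_k).
Implicit Types (s t u v b : seq 'I_k) (S E : seq (seq 'I_k)) (x y l r : 'I_k).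

Definition follows u x := forall w : word k n, tval w = u -> f w = x.

(* [t] reads each string of [S] once.  The successor of [l b], the last string
   read, is not visible in [t], and no claim is made on the strings of [E],
   whose successors change when further children are inserted. *)
Definition closed_walk t S E b l r :=
  [/\ suffix (l :: b) t, prefix (rcons b r) t, perm_eq (windows n t) S
    & forall w : word k n, tval w \in S -> tval w \notin E -> tval w <> l :: b ->
        infix (rcons w (f w)) t].

Lemma prefix_catl_size u s t v : size u <= size s ->
  prefix u (s ++ t) -> prefix u (s ++ v).
Proof. by move=> h; rewrite !prefixE !takel_cat. Qed.

Lemma suffix_catr_size u s t v : size u <= size s ->
  suffix u (t ++ s) -> suffix u (v ++ s).
Proof.
by rewrite /suffix !rev_cat => h; apply: prefix_catl_size; rewrite !size_rev.
Qed.

(** The old text passes through [x b x]; inserting [v] turns this into [x b r] and, later, [l b x].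
    No other successor changes, so [x b] leaves the set of exceptions. *)
Lemma closed_walk_mid u x b t S E E' b0 l0 r0 v S' l r : size b = n -> size b0 = n ->
  closed_walk (rcons u x ++ b ++ x :: t) S E b0 l0 r0 ->
  closed_walk v S' [::] b l r ->
  follows (x :: b) r -> follows (l :: b) x ->
  {subset E <= (x :: b) :: E'} ->
  closed_walk (rcons u x ++ v ++ x :: t) (S ++ S') E' b0 l0 r0.
Proof.
move=> hb hb0 [h1 h2 h3 h4] [h1' h2' h3' h4'] hr hl hE.
have /suffixP[v2 hv2] := h1'; have /prefixP[v1 hv1] := h2'.
have hv1' : v = b ++ r :: v1 by rewrite hv1 cat_rcons.
have hv2' : v = rcons v2 l ++ b by rewrite cat_rcons.
have pv : prefix b v by rewrite hv1' prefix_prefix.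
have sv : suffix b v by rewrite hv2' suffix_suffix.
have Hxr : infix (rcons (x :: b) r) (rcons u x ++ v ++ x :: t).
  by apply/infixP; exists u, (v1 ++ x :: t); rewrite cat_rcons hv1 /= !cat_rcons -!catA.
have Hlx : infix (rcons (l :: b) x) (rcons u x ++ v ++ x :: t).
  by apply/infixP; exists (rcons u x ++ v2), t; rewrite hv2 -!catA [rcons (l :: b) x ++ t]cat_rcons.
split.
- rewrite hv2' -!catA catA; apply: suffix_catr_size h1 => /=.
  by rewrite size_cat /= hb hb0 addnS ltnS leq_addr.
- rewrite hv1' -!catA catA; move: h2; rewrite catA; apply: prefix_catl_size.
  by rewrite size_cat !size_rcons hb hb0; lia.
- exact: perm_trans (perm_windows_glue _ _ hb pv sv) (perm_cat h3 h3').
move=> w; rewrite mem_cat => /orP[hw|hw] hwE hne.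
  case: (tval w =P x :: b) => hwx; first by rewrite hwx (hr _ hwx).
  have /h4 : tval w \notin E.
    by apply/negP => /hE; rewrite inE (negPf hwE) orbF => /eqP.
  move=> /(_ hw hne) /(infix_glue_mid hb _ pv sv); rewrite size_rcons size_tuple => /(_ erefl).
  by case=> //; rewrite -rcons_cons => /rcons_inj[/hwx].
case: (tval w =P l :: b) => hwl; first by rewrite hwl (hl _ hwl).
by rewrite infix_catl // infix_catr //; exact: h4'.
Qed.

(** The old walk ends with [x b], whose successor was still open. Putting [v] in place of the final
    [b] fixes it to [r], and [l b] becomes the new last string. *)
Lemma closed_walk_end u x b S E r0 v S' l r : size b = n ->
  closed_walk (rcons u x ++ b) S E b x r0 ->
  closed_walk v S' [::] b l r -> follows (x :: b) r ->
  closed_walk (rcons u x ++ v) (S ++ S') E b l r0.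
Proof.
move=> hb [_ h2 h3 h4] [h1' h2' h3' h4'] hr.
have /suffixP[v2 hv2] := h1'; have /prefixP[v1 hv1] := h2'.
have hv1' : v = b ++ r :: v1 by rewrite hv1 cat_rcons.
have hv2' : v = rcons v2 l ++ b by rewrite cat_rcons.
have pv : prefix b v by rewrite hv1' prefix_prefix.
have sv : suffix b v by rewrite hv2' suffix_suffix.
split.
- exact: suffix_catr.
- rewrite hv1' catA; apply: prefix_catl_size (prefix_catl [::] h2).
  by rewrite size_cat !size_rcons; lia.
- have := perm_windows_glue (rcons u x) [::] hb pv sv; rewrite !cats0 => /perm_trans; apply.
  exact: perm_cat.
move=> w; rewrite mem_cat => /orP[hw|hw] hwE hne; last exact/infix_catl/h4'.
case: (tval w =P x :: b) => hwx.
  by rewrite hwx (hr _ hwx) hv1; apply/infixP; exists u, v1; rewrite cat_rcons.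
by rewrite hv1' catA infix_catr // h4.
Qed.

(** Mirror case: [v] replaces the initial [b], so [l b] is followed by the old opening letter [x],
    and the letter due after the last string becomes [r]. *)
Lemma closed_walk_front b x t S E l0 v S' l r : size b = n ->
  closed_walk (b ++ x :: t) S E b l0 x ->
  closed_walk v S' [::] b l r -> follows (l :: b) x ->
  closed_walk (v ++ x :: t) (S ++ S') E b l0 r.
Proof.
move=> hb [h1 _ h3 h4] [h1' h2' h3' h4'] hl.
have /suffixP[v2 hv2] := h1'; have /prefixP[v1 hv1] := h2'.
have hv1' : v = b ++ r :: v1 by rewrite hv1 cat_rcons.
have hv2' : v = rcons v2 l ++ b by rewrite cat_rcons.
have pv : prefix b v by rewrite hv1' prefix_prefix.
have sv : suffix b v by rewrite hv2' suffix_suffix.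
split.
- rewrite hv2' -catA; move: (suffix_catr [::] h1); apply: suffix_catr_size.
  by rewrite size_cat /=; lia.
- exact: prefix_catl.
- have := perm_windows_glue [::] (x :: t) hb pv sv => /perm_trans; apply.
  exact: perm_cat.
move=> w; rewrite mem_cat => /orP[hw|hw] hwE hne.
  by rewrite hv2' -catA infix_catl // h4.
case: (tval w =P l :: b) => hwl; last exact/infix_catr/h4'.
by rewrite hwl (hl _ hwl) hv2; apply/infixP; exists v2, t; rewrite -catA /= cat_rcons.
Qed.

End ClosedWalks.

(** * Cycle-joining trees and chains *)

(** Equality of trees is decided classically, so that children can be treated as members of a
    sequence. *)
HB.instance Definition _ k n := boolp.gen_eqMixin (tree k n).

Section Trees.
Variables k n : nat.
Implicit Types (T : tree k n) (a p q : word k n) (ch : seq (cpair k n * tree k n)).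

Lemma tree_nested_ind (P : tree k n -> Prop) :
  (forall a ch, {in ch, forall e, P e.2} -> P (Node a ch)) -> forall T, P T.
Proof.
move=> H; fix IH 1 => -[a ch]; apply: H.
(* Clearing [IH] keeps automation from closing the empty case by an unguarded recursive call. *)
elim: ch => [|[e T] ch IHch] d; first by clear IH.
rewrite inE => /predU1P[->|/IHch]; [exact: IH | by []].
Qed.

Lemma mem_root_label T : root_label T \in nodes T.
Proof. by case: T => a ch; rewrite inE eqxx. Qed.

Lemma mem_child_nodes a ch e q : e \in ch -> q \in nodes e.2 -> q \in nodes (Node a ch).
Proof.
move=> he hq; rewrite /= inE; apply/orP; right; apply/flattenP; exists (nodes e.2) => //.
by apply/mapP; exists e.
Qed.

Lemma mem_child_edges a ch e d : e \in ch -> d \in edges e.2 -> d \in edges (Node a ch).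
Proof.
move=> he hd; apply/flattenP; exists ((a, root_label e.2, e.1) :: edges e.2).
  by apply/mapP; exists e.
by rewrite inE hd orbT.
Qed.

Lemma mem_root_edge a ch e : e \in ch -> (a, root_label e.2, e.1) \in edges (Node a ch).
Proof.
move=> he; apply/flattenP; exists ((a, root_label e.2, e.1) :: edges e.2).
  by apply/mapP; exists e.
by rewrite inE eqxx.
Qed.

Lemma edgesP a ch d : d \in edges (Node a ch) ->
  exists2 e, e \in ch & d = (a, root_label e.2, e.1) \/ d \in edges e.2.
Proof.
case/flattenP => s /mapP[e he ->]; rewrite inE => /orP[/eqP|] hd.
  by exists e => //; left.
by exists e => //; right.
Qed.

(** Both lists are in preorder, each edge being listed where its child is. When the nodes are
    distinct, a node thus has at most one edge from a parent. *)
Lemma edges_childrenE T : [seq d.1.2 | d <- edges T] = behead (nodes T).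
Proof.
elim/tree_nested_ind: T => a ch IH /=; rewrite map_flatten -map_comp; congr flatten.
by apply/eq_in_map => e /IH /= ->; case: e.2.
Qed.

Lemma edge_child T d : d \in edges T -> d.1.2 \in behead (nodes T).
Proof. by rewrite -edges_childrenE => /(map_f (fun d => d.1.2)). Qed.

Lemma edge_subseq T p q e : (p, q, e) \in edges T -> subseq [:: p; q] (nodes T).
Proof.
elim/tree_nested_ind: T => a ch IH hd; have := edge_child hd.
have [[e0 T0] he [[-> _ _]|/(IH _ he)]] := edgesP hd.
  by rewrite /= eqxx sub1seq.
move=> h _; apply: subseq_trans (subseq_cons _ _); apply: subseq_trans h _.
elim: ch he {IH hd} => //= e1 ch IH; rewrite inE => /orP[/eqP <-|/IH h].
  exact: prefix_subseq.
exact: subseq_trans h (suffix_subseq _ _).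
Qed.

Section Uniq.
Variable T : tree k n.
Hypothesis hT : uniq (nodes T).

(** Position in preorder is a rank that grows along downward paths; it rules out repetitions on
    them. *)
Lemma edge_index p q e : (p, q, e) \in edges T -> index p (nodes T) < index q (nodes T).
Proof.
move=> /edge_subseq; elim: (nodes T) hT => //= a s IH /andP[has hs].
have [_|_] := eqVneq p a.
  by rewrite sub1seq => hq; case: eqVneq has => // ->; rewrite hq.
move=> h; rewrite (_ : (a == q) = false) ?ltnS; first exact: IH.
by apply: contraNF has => /eqP ->; apply: (mem_subseq h); rewrite !inE eqxx orbT.
Qed.

Lemma edge_inj_child p p' q e e' :
  (p, q, e) \in edges T -> (p', q, e') \in edges T -> p = p' /\ e = e'.
Proof.
move=> h h'; have huniq : uniq [seq d.1.2 | d <- edges T].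
  by rewrite edges_childrenE; case: (nodes T) hT => //= a s /andP[].
have [i hi Ei] := nthP (p, q, e) h; have [j hj Ej] := nthP (p, q, e) h'.
have : i = j; last by move=> E; move: Ej; rewrite -E Ei => -[].
apply/eqP; rewrite -(nth_uniq q _ _ huniq) ?size_map //.
by rewrite !(nth_map (p, q, e)) // Ei Ej.
Qed.

Lemma edge_into_root p e : (p, root_label T, e) \notin edges T.
Proof.
apply/negP => /edge_child /=; case: T hT => a ch /= /andP[h _]; exact/negP.
Qed.

Lemma edge_nodes p q e : (p, q, e) \in edges T -> p \in nodes T /\ q \in nodes T.
Proof.
by move/edge_subseq/mem_subseq => h; split; apply: h; rewrite !inE eqxx ?orbT.
Qed.

End Uniq.

Lemma uniq_child_nodes a ch e : uniq (nodes (Node a ch)) -> e \in ch -> uniq (nodes e.2).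
Proof.
move=> /= /andP[_]; elim: ch => //= e' ch IH; rewrite cat_uniq inE => /and3P[h _ /IH h'].
by case/orP => [/eqP->|/h'].
Qed.

Lemma child_nodes_disjoint a ch e e' q : uniq (nodes (Node a ch)) -> e \in ch -> e' \in ch ->
  q \in nodes e.2 -> q \in nodes e'.2 -> e = e'.
Proof.
move=> /= /andP[_]; elim: ch => //= e1 ch IH; rewrite cat_uniq => /and3P[_ /hasPn h /IH{}IH].
have H e2 : e2 \in ch -> q \in nodes e2.2 -> q \notin nodes e1.2.
  move=> he hq; apply: h; apply/flattenP; exists (nodes e2.2) => //.
  by apply/mapP; exists e2.
rewrite !inE => /orP[/eqP->|he] /orP[/eqP->|he'] // hq hq'.
- by case/negP: (H _ he' hq').
- by case/negP: (H _ he hq).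
- exact: IH.
Qed.

Lemma uniq_children a ch : uniq (nodes (Node a ch)) -> uniq ch.
Proof.
move=> /= /andP[_]; elim: ch => //= e ch IH; rewrite cat_uniq => /and3P[_ /hasPn h /IH->].
rewrite andbT; apply/negP => he; have := mem_root_label e.2; apply/negP/h.
by apply/flattenP; exists (nodes e.2); [apply/mapP; exists e | exact: mem_root_label].
Qed.

Lemma child_edges_from a ch e p q d : uniq (nodes (Node a ch)) -> e \in ch ->
  p \in nodes e.2 -> (p, q, d) \in edges (Node a ch) -> (p, q, d) \in edges e.2.
Proof.
move=> hu he hp /edgesP[e' he' [[E _ _]|h]].
  move: hu; rewrite /= -E; case/andP => /flattenP[].
  by exists (nodes e.2) => //; apply/mapP; exists e.
by rewrite (child_nodes_disjoint hu he he' hp) //; case: (edge_nodes h).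
Qed.

End Trees.

(** * Maximal paths of a relation deterministic in both directions *)

Section MaximalPaths.
Variables (A : eqType).

Lemma maximal_path_suffix (R : rel A) e s1 s2 :
  (forall u v v', R u v -> R u v' -> v = v') ->
  path R e s1 -> path R e s2 ->
  (forall u, ~~ path R e (rcons s1 u)) -> (forall u, ~~ path R e (rcons s2 u)) -> s1 = s2.
Proof.
move=> det; elim: s1 s2 e => [|v1 s1 IH] [|v2 s2] e //=.
- by move=> _ /andP[h _] /(_ v2); rewrite h.
- by move=> /andP[h _] _ _ /(_ v1); rewrite h.
move=> /andP[h1 p1] /andP[h2 p2]; rewrite -(det _ _ _ h1 h2) h1 /= in p2 * => m1 m2.
by rewrite (IH s2 v1).
Qed.

(** Split both paths at the common entry [e]. Forward determinism makes the tails agree, and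
    backward determinism the heads, read in reverse. *)
Lemma maximal_path_inj (R : rel A) e s s' :
  (forall u v v', R u v -> R u v' -> v = v') ->
  (forall u u' v, R u v -> R u' v -> u = u') ->
  sorted R s -> sorted R s' ->
  (forall u, ~~ sorted R (u :: s) && ~~ sorted R (rcons s u)) ->
  (forall u, ~~ sorted R (u :: s') && ~~ sorted R (rcons s' u)) ->
  e \in s -> e \in s' -> s = s'.
Proof.
move=> fdet bdet hs hs' ms ms' /splitPr es /splitPr es'.
case: es hs ms => X1 Y1 hs ms; case: es' hs' ms' => X2 Y2 hs' ms'.
have sortE (Q : rel A) X Y : sorted Q (X ++ e :: Y) = sorted Q (rcons X e) && path Q e Y.
  by case: X => //= a X; rewrite cat_path rcons_path /= andbA.
have mY X Y : sorted R (X ++ e :: Y) ->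
    (forall u, ~~ sorted R (u :: X ++ e :: Y) && ~~ sorted R (rcons (X ++ e :: Y) u)) ->
    path R e Y /\ forall u, ~~ path R e (rcons Y u).
  rewrite sortE => /andP[hX hY] m; split=> // u; have /andP[_] := m u.
  by rewrite rcons_cat rcons_cons sortE hX.
have mX X Y : sorted R (X ++ e :: Y) ->
    (forall u, ~~ sorted R (u :: X ++ e :: Y) && ~~ sorted R (rcons (X ++ e :: Y) u)) ->
    path (fun x y => R y x) e (rev X) /\ forall u, ~~ path (fun x y => R y x) e (rcons (rev X) u).
  have E Z : path (fun x y => R y x) e (rev Z) = sorted R (rcons Z e).
    by rewrite -rev_sorted rev_rcons.
  rewrite E sortE => /andP[hX hY] m; split=> // u; have /andP[+ _] := m u.
  by rewrite -rev_cons E -cat_cons sortE hY andbT.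
have [pY1 mY1] := mY _ _ hs ms; have [pY2 mY2] := mY _ _ hs' ms'.
have [pX1 mX1] := mX _ _ hs ms; have [pX2 mX2] := mX _ _ hs' ms'.
congr (_ ++ e :: _); last exact: maximal_path_suffix mY1 mY2.
apply: (can_inj (@revK _)); apply: maximal_path_suffix mX1 mX2 => // u v v'; exact: bdet.
Qed.

End MaximalPaths.

(** * Chains and the values of the successor rules on them *)

Section Chains.
Variables (k n : nat) (G : tree k n).
Hypotheses (hG : cycle_joining_tree G) (hchain : chain_property G).
Implicit Types (a p q : word k n) (b : n.-tuple 'I_k) (x y : 'I_k) (s : seq (word k n * 'I_k)).

Lemma mem_necklace_class a w : (w \in necklace_class a) = (tval w \in rotations a).
Proof.
apply/imsetP/idP => [[i _ ->]|].
  by apply/mem_rotations; rewrite ?size_tuple //; exists i; rewrite turn_rot // size_tuple ltnW.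
rewrite mem_undup => /mapP[i]; rewrite mem_iota size_tuple add0n => /= hi h.
by exists (Ordinal hi) => //; apply: val_inj.
Qed.

Lemma uniq_nodes : uniq (nodes G).
Proof. by case: hG => /map_uniq. Qed.

(** Classes sharing a string coincide, and distinct nodes have distinct classes. *)
Lemma rotations_node_inj p q u : p \in nodes G -> q \in nodes G ->
  u \in rotations p -> u \in rotations q -> p = q.
Proof.
move=> hp hq hup huq; have hcl : necklace_class p = necklace_class q.
  have sz (a : word k n) : 0 < size a by rewrite size_tuple.
  have [i hi] := mem_rotations u (sz p) hup; have [j hj] := mem_rotations u (sz q) huq.
  apply/setP => w; rewrite !mem_necklace_class -(rotations_turn i (sz p)).
  by rewrite -(rotations_turn j (sz q)) -hi -hj.
have [i hi Ei] := nthP p hp; have [j hj Ej] := nthP p hq.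
case: hG => + _ => /(uniqP (necklace_class p)) H; rewrite -Ei -Ej; congr nth.
by apply: H; rewrite ?inE ?size_map ?(nth_map p) ?Ei ?Ej.
Qed.

Lemma edge_rotations p q x y b : (p, q, (x, y, b)) \in edges G ->
  x :: b \in rotations p /\ y :: b \in rotations q.
Proof. by case: hG => _ /allP H /H /and3P[_]; rewrite !mem_necklace_class. Qed.

Definition link b (u v : word k n * 'I_k) := (u.1, v.1, (u.2, v.2, b)) \in edges G.

Lemma link_inj_child b u u' v : link b u v -> link b u' v -> u = u'.
Proof.
move=> h h'; have [] := edge_inj_child uniq_nodes h h'.
by case: u u' {h h'} => [? ?] [? ?] /= -> [->].
Qed.

(** This is the Chain Property: distinct children of one node cannot share the linking string
    [b]. *)
Lemma link_inj_parent b u v v' : link b u v -> link b u v' -> v = v'.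
Proof.
move=> h h'; have E : v.1 = v'.1.
  by case: (eqVneq v.1 v'.1) => // ne; have := hchain h h' ne; rewrite eqxx.
rewrite /link -E in h'; have [_] := edge_inj_child uniq_nodes h h'.
by case: v v' E {h h'} => [? ?] [? ?] /= -> [->].
Qed.

Lemma in_path_link b s u : is_path G b s -> 1 < size s -> u \in s ->
  exists v, link b u v \/ link b v u.
Proof.
move=> + + /splitPr hu; case: hu => X [|v Y].
  case/lastP: X => //= X v; rewrite cat_rcons /is_path => h _.
  exists v; right; case: X h => [|a X] /=; first by case/andP.
  by rewrite cat_path /= => /and3P[_ _ /andP[]].
move=> h _; exists v; left; case: X h => [|a X] /=; first by case/andP.
by rewrite /is_path /= cat_path /= => /and3P[_ _ /andP[]].
Qed.

Lemma in_path b s u : is_path G b s -> 1 < size s -> u \in s ->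
  [/\ u.1 \in nodes G, u.2 :: b \in rotations u.1
    & in_conjugate_pair G [tuple of u.2 :: b]].
Proof.
move=> h hs hu; have [v [H|H]] := in_path_link h hs hu.
  have [h1 _] := edge_nodes H; have [h2 _] := edge_rotations H.
  by split=> //; apply/hasP; exists (u.1, v.1, (u.2, v.2, b)) => //; rewrite eqxx.
have [_ h1] := edge_nodes H; have [_ h2] := edge_rotations H.
by split=> //; apply/hasP; exists (v.1, u.1, (v.2, u.2, b)) => //; rewrite eqxx orbT.
Qed.

Lemma path_uniq_nodes b s : is_path G b s -> uniq (unzip1 s).
Proof.
move=> h; apply: (@map_uniq _ _ (fun p => index p (nodes G))).
apply: (sorted_uniq ltn_trans ltnn); rewrite -map_comp sorted_map.
by apply: sub_sorted h => u v /= /(edge_index uniq_nodes).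
Qed.

(** Equal letters would put the same string [x b] in the classes of two nodes. Hence [index] in [g]
    finds the right position. *)
Lemma path_uniq_letters b s : is_path G b s -> 1 < size s -> uniq (unzip2 s).
Proof.
move=> h hs; rewrite map_inj_in_uniq ?(map_uniq (path_uniq_nodes h)) //.
move=> [p x] [q y] hu hv /= E; rewrite -E in hv *.
have [h1 h2 _] := in_path h hs hu; have [h3 h4 _] := in_path h hs hv.
by have /= -> := rotations_node_inj h1 h3 h2 h4.
Qed.

(** Shows that the length bound built into [chain_of] excludes no chain. *)
Lemma path_size b s : is_path G b s -> 1 < size s -> size s <= size (nodes G).
Proof.
move=> h hs; rewrite -(size_map fst); apply: uniq_leq_size (path_uniq_nodes h) _.
by move=> _ /mapP[u hu ->]; have [] := in_path h hs hu.
Qed.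

(** The string [x b] determines its node, so the two chains share an entry and maximality makes them
    equal. *)
Lemma chain_inj b s s' x : is_chain G b s -> is_chain G b s' ->
  x \in unzip2 s -> x \in unzip2 s' -> s = s'.
Proof.
move=> /and3P[hs ps /forallP ms] /and3P[hs' ps' /forallP ms'].
move=> /mapP[[p y] hu /= ->] /mapP[[q z] hv /= E]; rewrite -E in hv.
have [h1 h2 _] := in_path ps hs hu; have [h3 h4 _] := in_path ps' hs' hv.
have /= Epq := rotations_node_inj h1 h3 h2 h4; rewrite -{}Epq in hv.
apply: (@maximal_path_inj _ (link b)) ms ms' hu hv => //.
  exact: link_inj_parent.
exact: link_inj_child.
Qed.

Lemma chain_ofE b s x : is_chain G b s -> x \in unzip2 s ->
  exists2 s', chain_of G [tuple of x :: b] = Some s' & bseqval s' = s.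
Proof.
move=> cs hx; rewrite /chain_of.
have -> : [tuple of behead [tuple of x :: b]] = b by apply: val_inj.
rewrite theadE; case: pickP => [s' /andP[cs' hx']|].
  by exists s' => //; exact: (chain_inj cs' cs hx' hx).
have sz : size s <= size (nodes G) by case/and3P: cs => hs ps _; exact: path_size ps hs.
by move/(_ (Bseq sz)); rewrite /= cs hx.
Qed.

(** Derangements count from 1 and sequences from 0, whence the predecessor. *)
Lemma f1_chain d b s i x : is_chain G b s -> i < size s ->
  (nth 0 (d s) i).-1 < size s ->
  f1 G d [tuple of nth x (unzip2 s) i :: b] = nth x (unzip2 s) (nth 0 (d s) i).-1.
Proof.
move=> cs hi hd; have hx : nth x (unzip2 s) i \in unzip2 s by rewrite mem_nth ?size_map.
have /and3P[hs ps _] := cs; have [s' Es' Es] := chain_ofE cs hx.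
have [u hu Eu] := mapP hx; have [_ _] := in_path ps hs hu.
rewrite -Eu /f1 => ->; rewrite /g Es' theadE Es index_uniq ?size_map ?(path_uniq_letters ps) //.
by apply: set_nth_default; rewrite size_map.
Qed.

(** Extend at either end while possible; the number of nodes bounds the length. *)
Lemma chain_extend b s : is_path G b s -> 1 < size s ->
  exists X Y, is_chain G b (X ++ s ++ Y).
Proof.
have [m] := ubnP (size (nodes G) - size s); elim: m s => // m IH s hm ps hs.
case cs : (is_chain G b s); first by exists [::], [::]; rewrite cats0.
have := path_size ps hs; rewrite leq_eqVlt => hsz.
move/negbT: cs; rewrite /is_chain hs ps /= negb_forall => /existsP[u].
rewrite negb_and !negbK => /orP[] h.
  have hle := @path_size b (u :: s) h (leqW hs).
  case: (IH (u :: s)) => [|//||X [Y h']]; [move: hle => /=; lia|exact: leqW|].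
  by exists (rcons X u), Y; rewrite cat_rcons.
have := @path_size b (rcons s u) h; rewrite size_rcons => /(_ (leqW hs)) hle.
case: (IH (rcons s u)) => [|//||X [Y h']]; rewrite ?size_rcons; [lia|exact: leqW|].
by exists X, (u :: Y); rewrite -cat_rcons.
Qed.

Lemma up_f1_chain b s i x : is_chain G b s -> i < size s ->
  up_f1 G [tuple of nth x (unzip2 s) i :: b] =
  nth x (unzip2 s) (if i.+1 < size s then i.+1 else 0).
Proof.
move=> cs hi.
have E : (nth 0 (rot 1 (iota 1 (size s))) i).-1 = if i.+1 < size s then i.+1 else 0.
  case: (size s) hi => // m hi; rewrite rot1_cons nth_rcons size_iota !ltnS.
  case: (ltngtP i m) => him; [by rewrite nth_iota | by lia | by []].
by rewrite /up_f1 f1_chain // E //; case: ifP => // _; exact: leq_ltn_trans hi.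
Qed.

Lemma down_f1_chain b s i x : is_chain G b s -> i < size s ->
  down_f1 G [tuple of nth x (unzip2 s) i :: b] =
  nth x (unzip2 s) (if i is j.+1 then j else (size s).-1).
Proof.
move=> cs hi.
have E : (nth 0 (rotr 1 (iota 1 (size s))) i).-1 = if i is j.+1 then j else (size s).-1.
  case: (size s) hi => // m hi; rewrite -[m.+1]addn1 iotaD cats1 rotr1_rcons addn1 add1n.
  by case: i hi => // i hi; rewrite /= nth_iota.
by rewrite /down_f1 f1_chain // E //; case: (i) hi => [|j] hi; lia.
Qed.

Lemma edge_chain p q x y b : (p, q, (x, y, b)) \in edges G ->
  exists X Y, is_chain G b (X ++ [:: (p, x), (q, y) & Y]).
Proof.
move=> h; have [|//|X [Y]] := @chain_extend b [:: (p, x); (q, y)].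
  by rewrite /is_path /= h.
by exists X, Y.
Qed.

Definition side_f1 d := if d is left_side then up_f1 G else down_f1 G.

(* The symbols before and after a linking string [b] in the closed walk of a
   subtree: one is the topmost letter of the chain of [b], the other the
   bottommost one. *)
Definition before d (top bot : 'I_k) := if d is left_side then bot else top.
Definition after d (top bot : 'I_k) := if d is left_side then top else bot.

(** The cyclic step between neighbours on a chain: on the left side [x b] is followed by [y], on the
    right side [y b] by [x]. *)
Lemma side_f1_edge d p q x y b : (p, q, (x, y, b)) \in edges G ->
  follows (side_f1 d) (before d y x :: b) (after d y x).
Proof.
move=> /edge_chain[X [Y cs]] w hw.
have hX : size (X ++ [:: (p, x), (q, y) & Y]) = size X + (size Y).+2 by rewrite size_cat.
have E i : nth x (unzip2 (X ++ [:: (p, x), (q, y) & Y])) (size X + i) =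
    nth x [:: x, y & unzip2 Y] i.
  by rewrite /unzip2 map_cat nth_cat size_map ltnNge leq_addr addKn.
have -> : w = [tuple of before d y x :: b] by apply: val_inj.
case: d {hw} => /=.
  have hi : size X + 0 < size (X ++ [:: (p, x), (q, y) & Y]) by rewrite hX; lia.
  have := up_f1_chain x cs hi; rewrite E /= => ->; rewrite hX -addnS.
  by case: ifP => [_|]; [rewrite E | lia].
have hi : size X + 1 < size (X ++ [:: (p, x), (q, y) & Y]) by rewrite hX; lia.
have := down_f1_chain x cs hi; rewrite E /= => ->.
by rewrite addn1 -[size X]addn0 E.
Qed.

(** The wrap-around step of the cyclic order, between the two ends of the chain. *)
Lemma side_f1_chain d p x s b : is_chain G b ((p, x) :: s) ->
  follows (side_f1 d) (before d x (last x (unzip2 s)) :: b) (after d x (last x (unzip2 s))).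
Proof.
move=> cs w hw; have hs : 1 < (size s).+1 by case/and3P: cs.
have El : nth x (unzip2 ((p, x) :: s)) (size s) = last x (unzip2 s).
  by rewrite (last_nth x) size_map.
have -> : w = [tuple of before d x (last x (unzip2 s)) :: b] by apply: val_inj.
case: d {hw} => /=.
  by have := up_f1_chain x cs (ltnSn (size s)); rewrite El ltnn.
by have := down_f1_chain (i := 0) x cs (ltn0Sn _); rewrite /= => ->; rewrite El.
Qed.

Lemma side_f1_thead d a : ~~ in_conjugate_pair G a -> side_f1 d a = thead a.
Proof. by move=> h; case: d; rewrite /= /up_f1 /down_f1 /f1 (negPf h). Qed.

End Chains.

(** * The closed walk of a subtree *)

Section PeriodicEnds.
Variables (A : eqType) (s : seq A) (p : nat).
Hypotheses (hp : p <= size s) (hrot : rot p s = s).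

(** By periodicity, one period put before a prefix of length [m] gives a prefix of length [m + p];
    [m0] caps [m] so that [m0 + p] stays within [s]. *)
Lemma prefix_take_period m m' t : prefix (take m s) t -> m' <= m + p ->
  prefix (take m' s) (take p s ++ t).
Proof.
move=> /prefixP[t' ->] hm; set m0 := minn m (size s - p).
have -> : take m' s = take m' (take (m0 + p) s).
  rewrite /m0; case: (leqP m (size s - p)) => h; first by rewrite take_takel.
  by rewrite subnK // take_size.
have hm0 : m0 + p <= size s by rewrite /m0; lia.
rewrite take_add_period //.
have /prefixP[w ->] : prefix (take m0 s) (take m s).
  by rewrite -[take m0 s](@take_takel _ m0 m) ?geq_minl // prefix_take.
by rewrite -catA catA; apply: prefix_catl; exact: prefix_take.
Qed.

Lemma suffix_drop_period m m' : m' <= m + p -> suffix (drop m s) (drop m' s ++ take p s).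
Proof.
move=> hm; set m0 := minn m (size s - p).
have dd i j : i <= j -> suffix (drop j s) (drop i s).
  by move=> h; rewrite -(subnK h) -drop_drop suffix_drop.
apply: suffix_trans (dd m0 m (geq_minl _ _)) _.
rewrite (drop_add_period hrot); last by rewrite /m0; lia.
case: (leqP m (size s - p)) => h.
  have /suffixP[w ->] : suffix (drop (m0 + p) s) (drop m' s) by apply: dd; rewrite /m0; lia.
  by rewrite -catA; exact: suffix_suffix.
by rewrite (drop_oversize (n := m0 + p)) ?suffix_suffix // /m0; lia.
Qed.

End PeriodicEnds.

Lemma cat_injl (A : Type) (u s t : seq A) : s ++ u = t ++ u -> s = t.
Proof.
move=> h; have := congr1 (take (size s)) h; rewrite take_size_cat // take_size_cat //.
by have := congr1 size h; rewrite !size_cat => /addIn.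
Qed.

Lemma cat_injr (A : Type) (u s t : seq A) : u ++ s = u ++ t -> s = t.
Proof. by elim: u => //= x u IH [/IH]. Qed.

Section SortedByKey.
Variables (A : eqType) (key : A -> nat).
Implicit Type s : seq A.

Lemma filter_leq_split s c : sorted leq [seq key e | e <- s] ->
  [seq e <- s | key e <= c] = [seq e <- s | key e < c] ++ [seq e <- s | key e == c].
Proof.
elim: s => //= e s IH hp; have {}IH := IH (path_sorted hp).
case: (ltngtP (key e) c) => he //=; first by rewrite IH.
have /allP hmin := order_path_min leq_trans hp.
rewrite IH (_ : [seq e <- s | key e < c] = [::]) //.
rewrite (@eq_in_filter _ _ pred0) ?filter_pred0 // => e' he' /=.
by apply/negbTE; rewrite -leqNgt -he hmin // map_f.
Qed.

Lemma filter_geq_split s c : sorted leq [seq key e | e <- s] ->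
  [seq e <- s | c <= key e] = [seq e <- s | key e == c] ++ [seq e <- s | c < key e].
Proof.
elim: s => //= e s IH hp; have {}IH := IH (path_sorted hp).
case: (ltngtP (key e) c) => he //=; last by rewrite IH.
have /allP hmin := order_path_min leq_trans hp.
rewrite IH (_ : [seq e <- s | key e == c] = [::]) //.
rewrite (@eq_in_filter _ _ pred0) ?filter_pred0 // => e' he' /=.
by apply/negbTE; rewrite gtn_eqF // (leq_trans he) // hmin // map_f.
Qed.

Lemma sorted_ltn_filter s (P : pred A) : sorted ltn [seq key e | e <- s] ->
  sorted ltn [seq key e | e <- s & P e].
Proof. by rewrite !sorted_map => h; apply: sorted_filter h => ? ? ?; exact: ltn_trans. Qed.

End SortedByKey.

Section ClosedWalkWeaken.
Variables (k n : nat) (f : word k n -> 'I_k).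

Lemma closed_walk_sub t S S' E E' b l r : perm_eq S S' -> {subset E <= E'} ->
  closed_walk f t S E b l r -> closed_walk f t S' E' b l r.
Proof.
move=> hS hE [h1 h2 h3 h4]; split=> //; first exact: perm_trans hS.
by move=> w; rewrite -(perm_mem hS) => hw hwE; apply: h4 => //; apply: contra hwE => /hE.
Qed.

Lemma closed_walk_drop_last t S E b l r :
  closed_walk f t S ((l :: b) :: E) b l r -> closed_walk f t S E b l r.
Proof.
move=> [h1 h2 h3 h4]; split=> // w hw hwE hne; apply: h4 => //.
by rewrite inE (negPf hwE) orbF; apply/eqP.
Qed.

End ClosedWalkWeaken.

(** * The RCL text of a subtree *)

Section RCLWalk.
Variables (k n : nat) (d : side).

Definition parent_symbol (e : cpair k n * tree k n) : 'I_k := e.1.1.1.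
Definition child_symbol (e : cpair k n * tree k n) : 'I_k := e.1.1.2.
Definition link_string (e : cpair k n * tree k n) : n.-tuple 'I_k := e.1.2.
Definition joined (e : cpair k n * tree k n) : seq 'I_k := parent_symbol e :: link_string e.
Definition join_index (a : seq 'I_k) c (e : cpair k n * tree k n) := child_index a c e.1.

Definition rcl_text (a : seq 'I_k) c (T : tree k n) := RCL (relabel d a c T).

Definition strings (T : tree k n) : seq (seq 'I_k) :=
  flatten [seq rotations (tval p) | p <- nodes T].

Definition child_text a c (e : cpair k n * tree k n) :=
  let i := join_index a c e in rcl_text (child_label a i e.1) i e.2.

Lemma strings_node w ch :
  strings (Node w ch) = rotations w ++ flatten [seq strings e.2 | e <- ch].
Proof.
rewrite /strings /=; congr (_ ++ _).
by elim: ch => //= e ch IH; rewrite map_cat flatten_cat IH.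
Qed.

(** A relabelled child has the change index it was given, so the children can be sorted and split
    before they are relabelled. *)
Lemma rcl_textE a c w ch :
  let es := sort (fun e e' => join_index a c e <= join_index a c e') ch in
  rcl_text a c (Node w ch) =
    flatten [seq child_text a c e | e <- es & ~~ is_left_child d c (join_index a c e)] ++
    take (period a) a ++
    flatten [seq child_text a c e | e <- es & is_left_child d c (join_index a c e)].
Proof.
move=> es; have apD u v : ap (u ++ v) = ap u ++ ap v :> seq 'I_k.
  by rewrite /ap map_cat flatten_cat.
have apF (us : seq (ctree k)) : 
      ap (flatten [seq rcl_labels u | u <- us]) = flatten [seq RCL u | u <- us].
  by elim: us => //= u us IH; rewrite apD IH.
rewrite /rcl_text /RCL /= apD apF -cat1s apD apF {1}/ap /= cats0 /aperiodic_prefix.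
have ci (e : cpair k n * tree k n) (a' : seq 'I_k) i :
    change_index (relabel d a' i e.2) = i by case: e => ? [].
rewrite !sort_map !filter_map -!map_comp.
set es1 := sort _ _.
have -> : es1 = es.
  by congr sort; apply: boolp.funext => e; apply: boolp.funext => e' /=; rewrite !ci.
by congr (flatten _ ++ _ ++ flatten _); congr map; apply: eq_filter => e /=; rewrite ci.
Qed.

End RCLWalk.

(** * The induction step at a node *)

Section SubtreeWalk.
Variables (k n : nat) (d : side) (G : tree k n).
Hypotheses (hG : cycle_joining_tree G) (hchain : chain_property G).
Let f := side_f1 G d.

(** The last condition keeps downward paths of [G] that start in [T] inside [T], so that chains can
    be taken in [G] throughout. *)
Definition subtree (T : tree k n) :=
  [/\ uniq (nodes T), {subset nodes T <= nodes G}, {subset edges T <= edges G}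
    & forall p q e, p \in nodes T -> (p, q, e) \in edges G -> (p, q, e) \in edges T].

(** [s] is the part below the root of [T] of the chain that passes through it with letter [y] and
    string [b], possibly empty; [z] is the bottom letter. *)
Definition subtree_walk (T : tree k n) (a : seq 'I_k) c (b : n.-tuple 'I_k) y :=
  exists s, [/\ path (link G b) (root_label T, y) s,
    forall u, ~~ path (link G b) (root_label T, y) (rcons s u)
  & let z := last y (unzip2 s) in
    closed_walk f (drop c a ++ rcl_text d a c T ++ take c.-1 a) (strings T) [::] b
      (before d y z) (after d y z)].

Lemma subtree_child w ch e : subtree (Node w ch) -> e \in ch -> subtree e.2.
Proof.
move=> [h1 h2 h3 h4] he; split.
- exact: uniq_child_nodes h1 he.
- by move=> q hq; apply: h2; exact: mem_child_nodes he hq.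
- by move=> q hq; apply: h3; exact: mem_child_edges he hq.
move=> p q e' hp /h4 h; apply: (child_edges_from h1 he hp); apply: h.
exact: mem_child_nodes he hp.
Qed.

Section Node.
Variables (w : word k n) (ch : seq (cpair k n * tree k n)) (a : seq 'I_k) (c : nat).
Variables (b : n.-tuple 'I_k) (y : 'I_k).
(** The label is [a = b1 y b2] with [c = |b1| + 1], and [b = b2 b1]. By [hin], an edge coming from a
    parent uses the same [b]. *)
Hypotheses (hsub : subtree (Node w ch)) (ha : a \in rotations w) (hc : 0 < c <= n.+1).
Hypotheses (hay : drop c.-1 a = y :: drop c a) (hab : tval b = drop c a ++ take c.-1 a).
Hypothesis (hin : forall u x z b', (u, w, (x, z, b')) \in edges G -> b' = b).

Local Notation idx := (join_index a c).
Local Notation px := parent_symbol.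
Local Notation pz := child_symbol.
Local Notation pb := link_string.
Local Notation lab e := (child_label a (idx e) e.1).
Let jp := c.-1 %/ period a * period a.

Let sza : size a = n.+1.
Proof. by rewrite (size_mem_rotations ha) size_tuple. Qed.

Let sza0 : 0 < size a. Proof. by rewrite sza. Qed.

Let ap0 : 0 < period a. Proof. by have [] := periodP sza0. Qed.
Let aprot : rot (period a) a = a. Proof. by have [] := periodP sza0. Qed.

Let rotw u : u \in rotations w -> u \in rotations a.
Proof.
have szw : 0 < size w by rewrite size_tuple.
by have [j ->] := mem_rotations _ szw ha; rewrite rotations_turn.
Qed.

Let rotaw u : u \in rotations a -> u \in rotations w.
Proof.
have szw : 0 < size w by rewrite size_tuple.
by have [j ->] := mem_rotations _ szw ha; rewrite rotations_turn.
Qed.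

Let jpc : jp < c <= jp + period a.
Proof.
have := divn_eq c.-1 (period a); have := ltn_pmod c.-1 ap0.
rewrite -/jp; move: (_ %% _) => r; lia.
Qed.

Let jpn : jp + period a <= n.+1.
Proof.
have [_ /dvdnP[q hq] _] := periodP sza0; rewrite -sza hq -mulSnr leq_mul2r.
by rewrite ltn_divLR // -hq sza; apply/orP; right; lia.
Qed.

(** The acceptable range is one period long, so its rotations are distinct; this makes change
    indices unique. *)
Let range_inj i j : jp < i <= jp + period a -> jp < j <= jp + period a ->
  rot i.-1 a = rot j.-1 a -> i = j.
Proof.
move=> hi hj; rewrite -!turn_rot ?sza; [|lia..].
have -> : i.-1 = jp + (i.-1 - jp) by lia.
have -> : j.-1 = jp + (j.-1 - jp) by lia.
rewrite !turnD => /turn_inj h.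
have E : i.-1 - jp = j.-1 - jp by apply: (turn_period_inj sza0) h; lia.
lia.
Qed.

Let yb : y :: b = rot c.-1 a. Proof. by rewrite hab -cat_cons -hay. Qed.

Let hyb : y :: b \in rotations w.
Proof.
apply: rotaw; apply/(mem_rotations _ sza0).
by exists c.-1; rewrite turn_rot ?sza; [exact: yb | lia].
Qed.

Lemma child_edge e : e \in ch -> (w, root_label e.2, (px e, pz e, pb e)) \in edges G.
Proof.
move=> he; have [_ _ h _] := hsub; apply: h; have := mem_root_edge w he.
by rewrite /parent_symbol /child_symbol /link_string; case: e {he} => [[[? ?] ?] ?].
Qed.

(** The range spans a full period, so the parent's string of the pair, a rotation of [a], is reached
    within it and the default of [child_index] does not occur. *)
Lemma child_indexP e : e \in ch ->
  [/\ jp < idx e <= jp + period a, drop (idx e).-1 a = px e :: drop (idx e) a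
    & tval (pb e) = drop (idx e) a ++ take (idx e).-1 a].
Proof.
move=> he; have [/rotw hx _] := edge_rotations hG (child_edge he).
have [m hm] := mem_rotations _ sza0 hx.
(* The rotation by [m] is moved into the range: adding [n.+1 - jp] stands for subtracting [jp],
   since the period divides [n.+1]. *)
pose i := (jp + (m + (n.+1 - jp)) %% period a).+1.
have hr := ltn_pmod (m + (n.+1 - jp)) ap0.
have hi : rot i.-1 a = px e :: pb e.
  rewrite hm -turn_rot ?sza /=; last by lia.
  rewrite turnD turn_modn ?turn_period // -turnD.
  have -> : jp + (m + (n.+1 - jp)) = m + n.+1 by lia.
  by rewrite turnD -sza turn_size.
have : idx e \in [seq i <- acceptable_range a c | rot i.-1 a == px e :: pb e].
  have : i \in [seq i <- acceptable_range a c | rot i.-1 a == px e :: pb e].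
    by rewrite mem_filter hi eqxx mem_iota /i -/jp; lia.
  rewrite /join_index /child_index /parent_symbol /link_string.
  case: e {he hx hm hi} => [[[x z] b'] T'] /=.
  by case: [seq _ <- _ | _] => //= i0 s _; rewrite inE eqxx.
rewrite mem_filter mem_iota -/jp => /andP[/eqP E hidx].
have hsz : (idx e).-1 < size a by rewrite sza; lia.
have := E; rewrite /rot (drop_nth (px e)) // prednK; last by lia.
by case=> E1 E2; split; [lia | rewrite E1 | rewrite E2].
Qed.

Lemma child_index_bound e : e \in ch -> 0 < idx e <= n.+1.
Proof. by move=> /child_indexP[h _ _]; lia. Qed.

(** Equal indices give equal linking strings, and the Chain Property then identifies the
    children. *)
Lemma idx_inj : {in ch &, injective idx}.
Proof.
move=> e e' he he' E; have [_ D1 B1] := child_indexP he; have [_ D2 B2] := child_indexP he'.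
have Eb : pb e = pb e' by apply: val_inj; rewrite /= B1 B2 E.
have Er : root_label e.2 = root_label e'.2.
  have h := child_edge he; have h' := child_edge he'; rewrite -Eb in h'.
  by apply/eqP; apply: contraT => /(hchain h h'); rewrite eqxx.
have [hu _ _ _] := hsub.
by apply: (child_nodes_disjoint hu he he' (mem_root_label _)); rewrite Er mem_root_label.
Qed.

(** Two strings of the class of [w] that both end in [b] have the same first letter, and [range_inj]
    then forces the index. *)
Lemma child_idx_c e : e \in ch -> pb e = b -> idx e = c /\ px e = y.
Proof.
move=> he Eb; have [hi D B] := child_indexP he.
have [hx _] := edge_rotations hG (child_edge he).
have Ex : px e = y by apply: (@rotations_head_inj _ w _ _ b) => //; rewrite -Eb.
split=> //; apply: range_inj => //.
by rewrite -yb -Ex -Eb /rot D B.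
Qed.

Lemma child_label_take e : e \in ch -> take (idx e).-1 (lab e) = take (idx e).-1 a.
Proof.
move=> he; have [hi _ _] := child_indexP he; rewrite /child_label.
case: (e.1) => [[x z] b'].
by rewrite takel_cat ?size_takel ?sza ?take_takel //; lia.
Qed.

Lemma child_label_drop_pred e : e \in ch -> drop (idx e).-1 (lab e) = pz e :: drop (idx e) a.
Proof.
move=> he; have [hi _ _] := child_indexP he; rewrite /child_label /child_symbol.
case: (e.1) => [[x z] b'] /=.
by rewrite drop_size_cat // size_takel // sza; lia.
Qed.

Lemma child_label_drop e : e \in ch -> drop (idx e) (lab e) = drop (idx e) a.
Proof.
move=> he; have [hi _ _] := child_indexP he.
have Ei : idx e = 1 + (idx e).-1 by lia.
by rewrite [X in drop X (child_label _ _ _)]Ei -drop_drop child_label_drop_pred //= drop0.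
Qed.

Lemma child_label_rotations e : e \in ch -> lab e \in rotations (root_label e.2).
Proof.
move=> he; have [hi D B] := child_indexP he.
have [_ hz] := edge_rotations hG (child_edge he).
have szr : 0 < size (root_label e.2) by rewrite size_tuple.
have szl : size (lab e) = n.+1.
  rewrite -(cat_take_drop (idx e).-1 (lab e)) child_label_take //.
  rewrite child_label_drop_pred // size_cat /=.
  by rewrite size_takel ?size_drop sza; lia.
have E : rot (idx e).-1 (lab e) = pz e :: pb e.
  by rewrite /rot child_label_take // child_label_drop_pred // B.
have [j hj] := mem_rotations _ szr hz.
rewrite -E -turn_rot in hj; last by rewrite szl; lia.
have [m hm] := turn_inv (idx e).-1 (lab e).
by apply/(mem_rotations _ szr); exists (m + j); rewrite turnD -hj hm.
Qed.

Hypothesis child_walk : forall e, e \in ch ->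
  subtree_walk e.2 (lab e) (idx e) (pb e) (pz e).

(** The child's label differs from [a] only at its change index, so the text around its walk is cut
    out of [a]. The path is extended upwards by [(w, px e)]. *)
Lemma child_closed_walk e : e \in ch ->
  exists s, [/\ path (link G (pb e)) (w, px e) ((root_label e.2, pz e) :: s),
    forall u, ~~ path (link G (pb e)) (w, px e) (rcons ((root_label e.2, pz e) :: s) u)
  & let z := last (pz e) (unzip2 s) in
    closed_walk f (drop (idx e) a ++ child_text d a c e ++ take (idx e).-1 a)
      (strings e.2) [::] (pb e) (before d (pz e) z) (after d (pz e) z)].
Proof.
move=> he; have [s [h1 h2 h3]] := child_walk he; exists s.
rewrite child_label_take // child_label_drop // in h3; split=> //=.
  by rewrite h1 andbT; exact: child_edge.
by move=> u; rewrite negb_and h2 orbT.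
Qed.

(** The chain of such a child starts at [w]: a link further up would be an edge into [w], so its
    string would be [b] and the index [c]. Of the two successors, one is a step along the edge and
    the other the wrap-around. *)
Lemma child_follows e s (z := last (pz e) (unzip2 s)) : e \in ch -> idx e <> c ->
  path (link G (pb e)) (w, px e) ((root_label e.2, pz e) :: s) ->
  (forall u, ~~ path (link G (pb e)) (w, px e) (rcons ((root_label e.2, pz e) :: s) u)) ->
  follows f (px e :: pb e) (after d (pz e) z) /\
  follows f (before d (pz e) z :: pb e) (px e).
Proof.
move=> he hne hp hm.
have cs : is_chain G (pb e) [:: (w, px e), (root_label e.2, pz e) & s].
  apply/and3P; split=> //; apply/forallP => u; rewrite [X in _ && X]hm andbT.
  apply/negP => /andP[+ _]; case: u => u x' /= h.
  by have [] := child_idx_c he (hin h).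
have := side_f1_edge (d := d) hG hchain (child_edge he).
by have := side_f1_chain (d := d) hG hchain cs; rewrite /f /z; case: (d) => /= h1 h2; split.
Qed.


(* Children with larger change indices are inserted first: the text [R] then
   always starts with the part of the parent label that the next child needs. *)
Lemma insert_children es L R S E j m l r :
  {subset es <= ch} -> (forall e, e \in es -> idx e <> c) ->
  path ltn j [seq idx e | e <- es] -> all (fun e => idx e <= m) es -> j <= m ->
  suffix (drop j a) L -> prefix (take m a) R ->
  closed_walk f (L ++ R) S E b l r ->
  forall E', {subset E <= [seq joined e | e <- es] ++ E'} ->
  prefix (take j a) (flatten [seq child_text d a c e | e <- es] ++ R) /\
  closed_walk f (L ++ flatten [seq child_text d a c e | e <- es] ++ R)
    (S ++ flatten [seq strings e.2 | e <- es]) E' b l r.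
Proof.
elim: es j => [|e es IH] j hes hne /=.
  move=> _ _ hjm hL hR hw E' hE; split.
    by apply: prefix_trans hR; rewrite -[take j a](@take_takel _ j m) // prefix_take.
  by apply: closed_walk_sub hw => //; rewrite cats0.
move=> /andP[hj hp] /andP[hm ha'] hjm hL hR hw E' hE.
have he : e \in ch by apply: hes; rewrite inE eqxx.
have [hi D B] := child_indexP he.
have dd i : i <= idx e -> suffix (drop (idx e) a) (drop i a).
  by move=> h; rewrite -(subnK h) -drop_drop suffix_drop.
have hji : suffix (drop (idx e).-1 a) L.
  apply: suffix_trans hL; have h : j <= (idx e).-1 by lia.
  by rewrite -(subnK h) -drop_drop suffix_drop.
(* The siblings with larger indices go in first; [joined e] stays an exception until [e] itself is
   inserted. *)
have [] := IH (idx e) _ _ hp ha' hm _ hR hw (joined e :: E').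
- by move=> e' h; apply: hes; rewrite inE h orbT.
- by move=> e' h; apply: hne; rewrite inE h orbT.
- by apply: suffix_trans (dd (idx e).-1 (leq_pred _)) hji.
- by move=> u /hE; rewrite !inE !mem_cat inE => /or3P[] ->; rewrite ?orbT.
move=> hR' hw'; have [s [h1 h2 hv]] := child_closed_walk he.
have hec : idx e <> c by apply: hne; rewrite inE eqxx.
have [hf1 hf2] := child_follows he hec h1 h2.
case/suffixP: hji => L' EL; case/prefixP: hR' => R' ER.
have Eta : take (idx e) a = rcons (take (idx e).-1 a) (px e).
  have h : (idx e).-1 < size a by rewrite sza; lia.
  rewrite -[X in take X a](prednK (n := idx e)); last by lia.
  rewrite (take_nth (px e)) //; congr rcons.
  by have := D; rewrite (drop_nth (px e)) // => -[].
set C := child_text d a c e in hv *.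
set F := flatten [seq child_text d a c e | e <- es] in hw' ER *.
split.
  have [_ /prefixP[V hV] _ _] := hv.
  (* The child's walk begins with its linking string [b2 b1]; cancelling [b2] shows that [C b1]
     begins with [b1], so the prefix needed by smaller indices survives. *)
  have CE : C ++ take (idx e).-1 a =
      take (idx e).-1 a ++ after d (pz e) (last (pz e) (unzip2 s)) :: V.
    move: hV; rewrite cat_rcons B -catA => /eqP.
    by rewrite eqseq_cat // eqxx => /eqP.
  rewrite -catA ER Eta cat_rcons catA CE -catA; apply: prefix_catl.
  by rewrite -[take j a](@take_takel _ j (idx e).-1) ?prefix_take //; lia.
(* [L] ends with [x b2] and the rest starts with [b1 x]: this is the passage [x b x] for the
   insertion. *)
have Eold : L ++ F ++ R = rcons L' (px e) ++ pb e ++ px e :: R'.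
  by rewrite ER EL D Eta !cat_rcons B -!catA.
have Enew : L ++ (C ++ F) ++ R =
    rcons L' (px e) ++ (drop (idx e) a ++ C ++ take (idx e).-1 a) ++ px e :: R'.
  by rewrite -catA ER EL D Eta !cat_rcons -!catA.
rewrite Enew; rewrite Eold in hw'.
have sb : size (pb e) = n by rewrite size_tuple.
have sb0 : size b = n by rewrite size_tuple.
have hsub1 : {subset joined e :: E' <= (px e :: pb e) :: E'} by [].
have := closed_walk_mid sb sb0 hw' hv hf1 hf2 hsub1; apply: closed_walk_sub => //.
by rewrite -catA perm_cat2l perm_catC.
Qed.

(** A string of this class in a conjugate pair is [joined e] for some child, if on the parent side,
    and [y b] if on the child side. The rule gives every other string its own first letter, as the
    text does. *)
Lemma base_closed_walk :
  closed_walk f (drop c a ++ take (period a) a ++ take c.-1 a) (rotations w)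
    [seq joined e | e <- ch] b y y.
Proof.
have hcn : 0 < c <= n.+1 := hc.
have pn : period a <= size a by have [_ /(dvdn_leq sza0)] := periodP sza0.
split.
- rewrite hab -cat_cons -hay !catA suffix_catl // eqxx /=.
  by apply: suffix_drop_period => //; lia.
- have -> : rcons b y = drop c a ++ take c a.
    rewrite hab rcons_cat; congr (_ ++ _).
    have h : c.-1 < size a by rewrite sza; lia.
    have := take_nth y h; rewrite prednK; last by lia.
    by move->; congr rcons; have := hay; rewrite (drop_nth y) // => -[].
  rewrite prefix_catr // eqxx /=; apply: (@prefix_take_period _ _ _ _ _ c.-1) => //.
    exact: prefix_refl.
  by lia.
- apply: perm_trans (perm_windows_rotation_walk sza hc) _.
  by apply: uniq_perm => [||u]; rewrite ?undup_uniq //; apply/idP/idP => [/rotaw|/rotw].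
move=> v hv hvE hne; apply: (infix_rotation_walk sza hc).
- exact: rotw.
- rewrite /f side_f1_thead; first by case: v {hv hvE hne} => -[|x v].
  apply/negP => /hasP[[[p q] [[x z] b']] hpq] /orP[] /eqP Ev.
    have [h1 _] := edge_rotations hG hpq; have [hp _] := edge_nodes hpq.
    have Ew : p = w.
      have [_ hn _ _] := hsub; apply: (rotations_node_inj hG hp _ h1); last by rewrite Ev in hv.
      by apply: hn; exact: mem_root_label (Node w ch).
    have [hu _ _ hfrom] := hsub; rewrite Ew in hpq.
    have /edgesP[e he [[_ Ee]|]] := hfrom _ _ _ (mem_root_label (Node w ch)) hpq.
      by case/mapP: hvE; exists e => //; rewrite Ev /joined /parent_symbol /link_string -Ee.
    case/edge_nodes => hw _; move: hu => /= /andP[/flattenP[]].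
    by exists (nodes e.2) => //; apply/mapP; exists e.
  have [_ h1] := edge_rotations hG hpq; have [_ hq] := edge_nodes hpq.
  have Ew : q = w.
    have [_ hn _ _] := hsub; apply: (rotations_node_inj hG hq _ h1); last by rewrite Ev in hv.
    by apply: hn; exact: mem_root_label (Node w ch).
  rewrite Ew in hpq; have Eb := hin hpq; apply: hne; rewrite Ev Eb /=; congr cons.
  by apply: (@rotations_head_inj _ w _ _ b) => //; rewrite -Eb; rewrite Ev in hv.
by apply/eqP => E; apply: hne; rewrite E hab -cat_cons -hay.
Qed.

Let es := sort (fun e e' => idx e <= idx e') ch.
Let lefts := [seq e <- es | idx e < c].
Let mids := [seq e <- es | idx e == c].
Let rights := [seq e <- es | c < idx e].

Let mem_es e : (e \in es) = (e \in ch). Proof. exact: mem_sort. Qed.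

Let sorted_es : sorted ltn [seq idx e | e <- es].
Proof.
rewrite ltn_sorted_uniq_leq map_inj_in_uniq ?sort_uniq.
  have [hu _ _ _] := hsub; rewrite (uniq_children hu) /= sorted_map.
  by apply: sort_sorted => e e'; exact: leq_total.
by move=> e e'; rewrite !mem_es; exact: idx_inj.
Qed.

Let sorted_leq_es : sorted leq [seq idx e | e <- es].
Proof. by move: sorted_es; rewrite ltn_sorted_uniq_leq => /andP[]. Qed.

Let perm_children : perm_eq ((lefts ++ mids) ++ rights) ch.
Proof.
rewrite -(filter_leq_split c sorted_leq_es).
have -> : rights = [seq e <- es | predC (fun e => idx e <= c) e].
  by apply: eq_filter => e /=; rewrite -ltnNge.
by rewrite (permPl (permEl (perm_filterC _ _))) perm_sort.
Qed.

Let text_of (s : seq (cpair k n * tree k n)) := flatten [seq child_text d a c e | e <- s].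
Let strings_of_children (s : seq (cpair k n * tree k n)) := flatten [seq strings e.2 | e <- s].

(** Children with index below [c] go after the aperiodic prefix. The text there still starts with
    [take jp a], so with one period in front it starts with [take (jp + period a) a], as the indices
    above [c] require. *)
Lemma interior_closed_walk :
  closed_walk f (drop c a ++ text_of rights ++ take (period a) a ++ text_of lefts ++ take c.-1 a)
    ((rotations w ++ strings_of_children lefts) ++ strings_of_children rights)
    [seq joined e | e <- mids] b y y.
Proof.
have hfilter P e : e \in [seq e <- es | P e] -> e \in ch /\ P e.
  by rewrite mem_filter mem_es => /andP[].
have base := base_closed_walk; rewrite catA in base.
have [||||||||hp hl] := @insert_children lefts _ _ _ _ jp c.-1 y y _ _ _ _ _ _ _ base
  [seq joined e | e <- rights ++ mids].
- by move=> e /hfilter[].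
- by move=> e /hfilter[_ h] E; move: h; rewrite E ltnn.
- rewrite path_min_sorted; first exact: sorted_ltn_filter.
  by apply/allP => _ /mapP[e /hfilter[/child_indexP[/andP[h _] _ _] _] ->].
- by apply/allP => e /hfilter[_ h]; lia.
- by lia.
- by apply: suffix_drop_period; [rewrite sza; lia | exact: aprot | lia].
- exact: prefix_refl.
- move=> u /mapP[e he ->]; rewrite -map_cat map_f //.
  rewrite -(perm_mem perm_children) !mem_cat in he *.
  by case/orP: he => [/orP[]|] ->; rewrite ?orbT.
have hR : prefix (take (jp + period a) a) (take (period a) a ++ text_of lefts ++ take c.-1 a).
  by apply: (prefix_take_period _ aprot hp); rewrite ?sza; lia.
rewrite -catA in hl.
have [|||||||_ hr] := @insert_children rights _ _ _ _ c (jp + period a) y y _ _ _ _ _ _ hR hl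
  [seq joined e | e <- mids].
- by move=> e /hfilter[].
- by move=> e /hfilter[_ h] E; move: h; rewrite E ltnn.
- rewrite path_min_sorted; first exact: sorted_ltn_filter.
  by apply/allP => _ /mapP[e /hfilter[_ h] ->].
- by apply/allP => e /hfilter[/child_indexP[/andP[_ h] _ _] _].
- by lia.
- exact: suffix_refl.
- by rewrite map_cat.
exact: hr.
Qed.

(** At most one child has index [c], and it alone is linked by [b]. Its walk replaces the final [b]
    on the left side and the initial [b] on the right side. *)
Lemma node_walk : subtree_walk (Node w ch) a c b y.
Proof.
have int := interior_closed_walk.
have hS : perm_eq (((rotations w ++ strings_of_children lefts) ++ strings_of_children rights)
    ++ strings_of_children mids) (strings (Node w ch)).
  rewrite strings_node -!catA perm_cat2l /strings_of_children -!flatten_cat -!map_cat.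
  apply/perm_flatten/perm_map; apply: perm_trans perm_children.
  by rewrite -catA perm_cat2l perm_catC.
have hW : rcl_text d a c (Node w ch) =
    (if d is left_side then [::] else text_of mids) ++ text_of rights ++ take (period a) a ++
    text_of lefts ++ (if d is left_side then text_of mids else [::]).
  have h1 : [seq e <- es | is_left_child d c (idx e)] =
      lefts ++ (if d is left_side then mids else [::]).
    by case: (d) => /=; rewrite ?cats0 // (filter_leq_split c sorted_leq_es).
  have h2 : [seq e <- es | ~~ is_left_child d c (idx e)] =
      (if d is left_side then [::] else mids) ++ rights.
    case: (d) => /=; first by apply: eq_filter => e; rewrite -ltnNge.
    by rewrite -(filter_geq_split c sorted_leq_es); apply: eq_filter => e; rewrite -leqNgt.
  rewrite rcl_textE h1 h2 /text_of !map_cat !flatten_cat -!catA.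
  by case: (d); rewrite /= ?cats0.
have hmid e : e \in mids -> [/\ e \in ch, idx e = c, pb e = b & px e = y].
  rewrite mem_filter mem_es => /andP[/eqP E he].
  have [_ _ B] := child_indexP he.
  have Eb : pb e = b by apply: val_inj; rewrite /= B hab E.
  by have [_ Ex] := child_idx_c he Eb.
have : size mids <= 1.
  have : uniq [seq idx e | e <- mids].
    have := sorted_ltn_filter (fun e => idx e == c) sorted_es.
    by rewrite ltn_sorted_uniq_leq => /andP[].
  case Em : mids hmid => [|e [|e' s]] //= hmid.
  have [_ -> _ _] := hmid e (mem_head _ _).
  have [|_ -> _ _] := hmid e'; first by rewrite !inE eqxx orbT.
  by rewrite inE eqxx.
case Em : mids hmid hS hW int => [|e [|//]] hmid hS hW int _.
  (* No child is linked by [b]: the chain stops at [w], with [y] as its bottom letter. *)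
  exists [::]; split=> //= [u|]; last first.
    rewrite /before /after hW; move: int hS; rewrite /strings_of_children /= cats0 => int hS.
    apply: (closed_walk_sub (E := [::]) hS) => //; move: int; rewrite /text_of.
    by case: (d); rewrite /= ?cats0 -!catA.
  rewrite andbT; apply/negP => h.
  have [hu _ _ hfrom] := hsub.
  have /edgesP[e he [[_ Ee]|]] := hfrom _ _ _ (mem_root_label (Node w ch)) h.
    have Eb : pb e = b by rewrite /link_string -Ee.
    have [Ec _] := child_idx_c he Eb.
    by have : e \in mids; [rewrite mem_filter Ec eqxx mem_es | rewrite Em].
  case/edge_nodes => hw _; move: hu => /= /andP[/flattenP[]].
  by exists (nodes e.2) => //; apply/mapP; exists e.
have [he Ec Eb Ex] := hmid e (mem_head _ _).
have [s [h1 h2 hv]] := child_closed_walk he.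
rewrite Eb Ex Ec in h1 h2 hv.
exists ((root_label e.2, pz e) :: s); split=> //.
(* The one remaining exception is [y b], the last string, on which a closed walk makes no claim. *)
rewrite /= /joined Ex Eb in int; have {}int := closed_walk_drop_last int.
have sb : size b = n by rewrite size_tuple.
have := side_f1_edge (d := d) hG hchain (child_edge he); rewrite -/f Eb Ex.
rewrite /text_of /strings_of_children /= !cats0 in hS hW int *.
have [Ed|Ed] : d = left_side \/ d = right_side by case: (d); [left | right].
  rewrite Ed /= in hW hv int * => hf.
  have [/suffixP[L hL] _ _ _] := int.
  rewrite hL -cat_rcons in int.
  have := closed_walk_end sb int hv hf; rewrite hW.
  suff -> : rcons L y ++ drop c a ++ child_text left_side a c e ++ take c.-1 a =
    drop c a ++ (flatten [seq child_text left_side a c e | e <- rights] ++ take (period a) a ++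
      flatten [seq child_text left_side a c e | e <- lefts] ++ child_text left_side a c e) ++
      take c.-1 a by exact: closed_walk_sub.
  rewrite !catA; congr ((_ ++ _) ++ _); apply: (@cat_injl _ (take c.-1 a)).
  by rewrite -!catA hL cat_rcons hab.
rewrite Ed /= in hW hv int * => hf.
have [_ /prefixP[R hR] _ _] := int.
rewrite hR cat_rcons in int.
have := closed_walk_front sb int hv hf; rewrite hW cats0.
suff -> : (drop c a ++ child_text right_side a c e ++ take c.-1 a) ++ y :: R =
  drop c a ++ (child_text right_side a c e ++
    flatten [seq child_text right_side a c e | e <- rights] ++ take (period a) a ++
    flatten [seq child_text right_side a c e | e <- lefts]) ++ take c.-1 a
  by exact: closed_walk_sub.
rewrite -!catA; congr (_ ++ _ ++ _); apply: (@cat_injr _ (drop c a)).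
by rewrite hR cat_rcons hab -catA.
Qed.

End Node.

End SubtreeWalk.

(** * From closed walks to universal cycles *)

Section PeriodicReading.
Variables (A : eqType) (M : nat) (x0 : A) (t : seq A).

Definition reading m L := mkseq (fun j => nth x0 t ((m + j) %% M)) L.

Lemma reading_modn m L : reading (m %% M) L = reading m L.
Proof. by apply: eq_mkseq => j /=; rewrite modnDml. Qed.

Lemma take_reading m L L' : L <= L' -> take L (reading m L') = reading m L.
Proof. by move=> h; rewrite /reading /mkseq -map_take take_iota (minn_idPl h). Qed.

Lemma windows_reading L u : size u = L + M ->
  (forall j, j < size u -> nth x0 u j = nth x0 t (j %% M)) ->
  windows L u = [seq reading m L.+1 | m <- iota 0 M].
Proof.
move=> hu hp; rewrite /windows hu addKn; apply/eq_in_map => m; rewrite mem_iota add0n => /= hm.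
apply: (@eq_from_nth _ x0) => [|j]; rewrite size_takel ?size_mkseq ?size_drop ?hu //; try lia.
by move=> hj; rewrite nth_mkseq // nth_take // nth_drop hp // hu; lia.
Qed.

End PeriodicReading.

(** * Closing up a walk to a cycle *)

Section ClosedWalkCycle.
Variables (k n : nat) (f : word k n -> 'I_k) (W : {set word k n}).
Variables (U b1 b2 : seq 'I_k) (S : seq (seq 'I_k)) (l r : 'I_k).
Let t := b2 ++ U ++ b1.
Let b := b2 ++ b1.
Hypotheses (hb : size b = n) (walk : closed_walk f t S [::] b l r).
Hypotheses (hlast : follows f (l :: b) r) (uS : uniq S).
Hypotheses (hS : forall w : word k n, (tval w \in S) = (w \in W)) (cS : size S = #|W|).

Let M := size U.
Let rd := reading M r t.

Let size_t : size t = n + M.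
Proof. by rewrite -hb !size_cat; lia. Qed.

Let M_gt0 : 0 < M.
Proof.
have [_ /size_prefix h _ _] := walk.
by move: h; rewrite size_rcons hb size_t; lia.
Qed.

(** One copy of [b r] opens [t r] and another, [M] letters later, closes it; so [t r] has period
    [M]. *)
Let nth_t j : j <= n + M -> nth r (rcons t r) j = nth r t (j %% M).
Proof.
elim/ltn_ind: j => j IH hj; case: (ltnP j M) => hjM.
  by rewrite modn_small // nth_rcons size_t ifT //; lia.
have -> : j %% M = (j - M) %% M by rewrite -[in LHS](subnK hjM) modnDr.
rewrite -IH; [|lia..].
have [/suffixP[u hu] /prefixP[v hv] _ _] := walk.
have su : size u = M.-1 by have := congr1 size hu; rewrite size_t size_cat /= hb; lia.
have Eu : rcons t r = rcons u l ++ rcons b r by rewrite hu rcons_cat cat_rcons.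
have Ev : rcons t r = rcons b r ++ rcons v r by rewrite hv rcons_cat.
rewrite {1}Eu Ev !nth_cat !size_rcons su prednK // ltnNge hjM /= hb ifT //; lia.
Qed.

Let size_tr : size (rcons t r) = n.+1 + M.
Proof. by rewrite size_rcons size_t. Qed.

Let windows_t : windows n t = [seq rd m n.+1 | m <- iota 0 M].
Proof.
apply: windows_reading => // j hj; rewrite -nth_t ?nth_rcons ?hj //.
by rewrite size_t in hj; lia.
Qed.

Let windows_tr : windows n.+1 (rcons t r) = [seq rd m n.+2 | m <- iota 0 M].
Proof. by apply: windows_reading => // j hj; apply: nth_t; rewrite size_tr in hj; lia. Qed.

Let rd_inj m m' : rd m n.+1 = rd m' n.+1 -> m %% M = m' %% M.
Proof.
move=> h; have [_ _ hperm _] := walk.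
have : uniq (windows n t) by rewrite (perm_uniq hperm).
rewrite windows_t => /(uniqP [::]) H.
rewrite /rd -(reading_modn _ _ _ m) -(reading_modn _ _ _ m') in h.
have hm i : i %% M < M by rewrite ltn_pmod.
apply: H; rewrite ?inE ?size_map ?size_iota ?hm //.
by rewrite !(nth_map 0) ?size_iota ?hm // !nth_iota ?hm.
Qed.

(** [U] sits in [t] at offset [size b2], which shifts all positions. *)
Let occursE i (w : seq 'I_k) : i < M -> occurs_at U i w = (rd (size b2 + i) (size w) == w).
Proof.
move=> hi; rewrite /occurs_at.
suff -> : [seq onth U ((i + j) %% size U) | j <- iota 0 (size w)] =
    map Some (rd (size b2 + i) (size w)) by apply: inj_eq; apply: inj_map => ? ? [].
rewrite /rd /reading /mkseq -map_comp; apply/eq_map => j /=.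
have hj : (i + j) %% M < M by rewrite ltn_pmod.
have EU q : q < M -> nth r U q = nth r t ((size b2 + q) %% M).
  move=> hq; have hsz : size b2 <= n by rewrite -hb size_cat leq_addr.
  rewrite -nth_t; last by lia.
  rewrite nth_rcons size_t ifT; last by lia.
  by rewrite /t nth_cat ltnNge leq_addr addKn nth_cat hq.
by rewrite onthE (nth_map r) // EU // modnDmr addnA.
Qed.

Lemma universal_cycle_of_closed_walk : universal_cycle W U.
Proof.
have [_ _ hperm _] := walk; split.
  by rewrite -cS -(perm_size hperm) size_windows size_t addKn.
move=> w; rewrite -hS => hw.
have := hw; rewrite -(perm_mem hperm) windows_t => /mapP[m].
rewrite mem_iota add0n => /= hm Ew.
(* The position in [U] is [m - size b2] modulo [M], written so that no subtraction is truncated. *)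
have Ei : (size b2 + (m + (M - size b2 %% M)) %% M) %% M = m.
  rewrite modnDmr -modnDml; have := ltn_pmod (size b2) M_gt0.
  move: (size b2 %% M) => q hq; have -> : q + (m + (M - q)) = m + M by lia.
  by rewrite modnDr modn_small.
exists ((m + (M - size b2 %% M)) %% M); split.
  split; first by rewrite ltn_pmod.
  by rewrite occursE ?ltn_pmod // size_tuple /rd -reading_modn Ei Ew.
move=> i [hi]; rewrite occursE // size_tuple => /eqP E.
have : (size b2 + i) %% M = (size b2 + (m + (M - size b2 %% M)) %% M) %% M.
  by rewrite Ei -[RHS](modn_small hm); apply: rd_inj; rewrite E Ew.
move/eqP; rewrite eqn_modDl modn_mod => /eqP <-.
by rewrite modn_small.
Qed.

(** In [t r] the last string [l b] also shows its successor. Each string has a single position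
    modulo [M], so its successor read in [t r] is the one read in the cycle. *)
Lemma successor_rule_of_closed_walk : has_successor_rule W U f.
Proof.
have [hsuf _ hperm hinf] := walk.
move=> w i; rewrite -hS => hw hi; rewrite !occursE // size_rcons size_tuple => /eqP E.
have : infix (rcons w (f w)) (rcons t r).
  case: (tval w =P l :: b) => hwl; last by rewrite -[rcons t r]cats1 infix_catr // hinf.
  rewrite (hlast hwl) hwl; case/suffixP: hsuf => u ->; apply/infixP.
  by exists u, [::]; rewrite cats0 rcons_cat.
move=> hin; have : rcons w (f w) \in windows n.+1 (rcons t r).
  by rewrite mem_windows size_rcons size_tuple eqxx.
rewrite windows_tr => /mapP[m _ Em].
have Ew : tval w = reading M r t m n.+1.
  have := congr1 (take n.+1) Em; rewrite take_reading // => <-.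
  by rewrite -cats1 take_size_cat // size_tuple.
have Emod : (size b2 + i) %% M = m %% M by apply: rd_inj; rewrite E.
by rewrite Em /rd -(reading_modn _ _ _ (size b2 + i)) Emod reading_modn.
Qed.

End ClosedWalkCycle.

(** * Induction over the tree and the case of the root *)

Section ConcatenationTrees.
Variables (k n : nat) (d : side) (G : tree k n).
Hypotheses (hG : cycle_joining_tree G) (hchain : chain_property G).

Lemma subtree_walk_all T a c b y : subtree G T -> a \in rotations (root_label T) ->
  0 < c <= n.+1 -> drop c.-1 a = y :: drop c a -> tval b = drop c a ++ take c.-1 a ->
  (forall u x z b', (u, root_label T, (x, z, b')) \in edges G -> b' = b) ->
  subtree_walk d G T a c b y.
Proof.
elim/tree_nested_ind: T a c b y => w ch IH a c b y hsub ha hc hay hab hin.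
apply: node_walk => // e he.
have [hi _ B] := child_indexP hG hsub ha hc hay hab he.
have ha' := child_label_rotations hG hsub ha hc hay hab he.
have hdrop := child_label_drop_pred hG hsub ha hc hay hab he.
apply: IH => //.
- exact: subtree_child hsub he.
- exact: (child_index_bound hG hsub ha hc hay hab he).
- by rewrite hdrop (child_label_drop hG hsub ha hc hay hab he).
- by rewrite B (child_label_take hG hsub ha hc hay hab he)
    (child_label_drop hG hsub ha hc hay hab he).
(* A node has one parent edge, so every edge into the child carries the string of its own pair. *)
move=> u x z b' h; have [_] := edge_inj_child (uniq_nodes hG) h (child_edge hsub he).
by case.
Qed.

Lemma uniq_strings : uniq (strings G).
Proof.
suff H s : uniq s -> {subset s <= nodes G} ->
    uniq (flatten [seq rotations (tval p) | p <- s]) by apply: H (uniq_nodes hG) _.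
elim: s => //= p s IH /andP[hp hs] hsub.
rewrite cat_uniq undup_uniq IH //=; last by move=> q hq; apply: hsub; rewrite inE hq orbT.
rewrite andbT; apply/hasPn => u /flattenP[_ /mapP[q hq ->] hu]; apply/negP => hu'.
have E : p = q.
  by apply: (rotations_node_inj hG) hu' hu; apply: hsub; rewrite inE ?eqxx ?hq ?orbT.
by rewrite E hq in hp.
Qed.

Lemma mem_strings (w : word k n) : (tval w \in strings G) = (w \in strings_of G).
Proof.
rewrite /strings /strings_of; elim: (nodes G) => [|p s IH] /=.
  by rewrite big_nil in_set0.
by rewrite mem_cat big_cons in_setU IH mem_necklace_class.
Qed.

Lemma size_strings : size (strings G) = #|strings_of G|.
Proof.
rewrite cardE -(size_map val); apply/perm_size/uniq_perm => [||u].
- exact: uniq_strings.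
- by rewrite map_inj_uniq ?enum_uniq //; exact: val_inj.
apply/idP/mapP => [hu|[w]]; last by rewrite mem_enum -mem_strings => hw ->.
have hsz : size u == n.+1.
  by case/flattenP: hu => _ /mapP[p _ ->] /size_mem_rotations ->; rewrite size_tuple.
by exists (Tuple hsz); rewrite // mem_enum -mem_strings.
Qed.

Lemma RCL_universal_cycle c : 1 <= c <= n.+1 ->
  universal_cycle (strings_of G) (RCL (Concat G c d)) /\
  has_successor_rule (strings_of G) (RCL (Concat G c d)) (side_f1 G d).
Proof.
move=> hc; set w := root_label G.
have szw : size w = n.+1 by rewrite size_tuple.
have hsz : size (drop c w ++ take c.-1 w) == n.
  by rewrite size_cat size_drop size_takel szw; lia.
pose b := Tuple hsz; pose y := nth (thead w) w c.-1.
have hwy : drop c.-1 w = y :: drop c w.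
  by rewrite (drop_nth (thead w)) ?szw ?prednK //; lia.
have hww : tval w \in rotations w.
  by apply/mem_rotations; rewrite ?szw //; exists 0.
have [||s [h1 h2 hwalk]] := @subtree_walk_all G w c b y _ hww hc hwy (erefl _).
- by split=> //; exact: uniq_nodes hG.
- by move=> u x z b' h; case/negP: (edge_into_root (uniq_nodes hG) u (x, z, b')).
set bot := last y (unzip2 s) in hwalk.
(* The last string must close the cycle. If a chain with string [b] starts at the root with letter
   [y], this is its wrap-around; otherwise [y b] lies in no conjugate pair and is followed by
   [y]. *)
have hlast : follows (side_f1 G d) (before d y bot :: b) (after d y bot).
  have hroot p x : ~~ link G b (p, x) (w, y) by apply: edge_into_root; exact: uniq_nodes.
  rewrite /bot; case: s h1 h2 {hwalk bot} => [_ h2|[q z] s h1 h2] /=; last first.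
    have := @side_f1_chain _ _ _ hG hchain d w y ((q, z) :: s) b; apply.
    apply/and3P; split=> //; apply/forallP => -[p x]; rewrite [X in _ && X]h2 andbT.
    by apply/negP => /andP[h _]; case/negP: (hroot p x).
  have -> : before d y y = y by case: (d).
  have -> : after d y y = y by case: (d).
  move=> v hv; rewrite side_f1_thead; first by case/tupleP: v hv => x v [-> _].
  have hyb : y :: b \in rotations w.
    by rewrite mem_undup; apply/mapP; exists c.-1; rewrite ?mem_iota ?szw /rot ?hwy //; lia.
  apply/negP => /hasP[[[p q] [[x z] b']] hpq] /orP[] /eqP Ev; move: hv; rewrite Ev => -[Ey Eb].
    have {}Eb : b' = b by apply: val_inj.
    have [h3 _] := edge_rotations hG hpq; have [hp _] := edge_nodes hpq.
    rewrite Ey Eb in h3 hpq.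
    have Ep := rotations_node_inj hG hp (mem_root_label G) h3 hyb; rewrite Ep in hpq.
    by have := h2 (q, z); rewrite /= andbT => /negP; apply.
  have {}Eb : b' = b by apply: val_inj.
  have [_ h3] := edge_rotations hG hpq; have [_ hq] := edge_nodes hpq.
  rewrite Ey Eb in h3 hpq.
  have Eq := rotations_node_inj hG hq (mem_root_label G) h3 hyb; rewrite Eq in hpq.
  by case/negP: (hroot p x).
have sb : size (drop c w ++ take c.-1 w) = n by apply/eqP.
split.
  exact: (universal_cycle_of_closed_walk sb hwalk uniq_strings mem_strings size_strings).
exact: (successor_rule_of_closed_walk sb hwalk hlast uniq_strings mem_strings size_strings).
Qed.

End ConcatenationTrees.

Theorem theorem2 (k n : nat) (T : tree k n) (c : nat)
    (hT : cycle_joining_tree T) (hchain : chain_property T)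
    (hc : 1 <= c <= n.+1) :
  (universal_cycle (strings_of T) (RCL (Concat T c left_side)) /\
   has_successor_rule (strings_of T) (RCL (Concat T c left_side)) (up_f1 T)) /\
  (universal_cycle (strings_of T) (RCL (Concat T c right_side)) /\
   has_successor_rule (strings_of T) (RCL (Concat T c right_side)) (down_f1 T)).
Proof.
by split; [exact: (@RCL_universal_cycle _ _ left_side)
          | exact: (@RCL_universal_cycle _ _ right_side)].
Qed.
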